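(* Let $\mathcal G=[\tfrac12,2]^2\cap\{(x_1,x_2)\in\mathbb R^2: x_1x_2\le1\}$, and let $\bar{\mathcal C}(\mathcal G)$ be the closed convex hull in $\mathbb S^3$ of the matrices $\begin{pmatrix}1\\ \mathbf x\end{pmatrix}\begin{pmatrix}1\\ \mathbf x\end{pmatrix}^{\top}$, $\mathbf x\in\mathcal G$. Then $$\bar{\mathcal C}(\mathcal G)=\left\{\begin{pmatrix}1&\mathbf x^\top\\ \mathbf x&X\end{pmatrix}\in\mathbb S^3\ \middle|\ \begin{pmatrix}1&\mathbf x^\top\\ \mathbf x&X\end{pmatrix}\succeq0,\ \begin{pmatrix}1&\mathbf x^\top\\ \mathbf x&X\end{pmatrix}\in\mathcal N_B^*,\ \begin{pmatrix}1&x_2&x_1\\ x_2&X_{22}&X_{12}\\ x_1&X_{12}&X_{11}\end{pmatrix}\in\mathcal N_B^*\right\}.$$ Moreover, $$\mathcal N_B^*=\mathcal D_1+\mathcal D_2+\mathcal D_3+\operatorname{span}\{z_Bz_B^\top\};$$ equivalently, $Y\in\mathcal N_B^*$ if and only if there exist $Y_i\in\mathcal D_i$ ($i=1,2,3$) and $\lambda\in\mathbb R$ such that $Y=Y_1+Y_2+Y_3+\lambda z_Bz_B^\top$. (In particular, this gives a finite semidefinite extended formulation of $\bar{\mathcal C}(\mathcal G)$.)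
   Context: $\mathbb S^n$ is the space of real symmetric $n\times n$ matrices with the trace inner product $U\bullet V=\operatorname{tr}(UV)$. A quadratic $q(\mathbf x)=\mathbf x^\top R\mathbf x+2\mathbf r^\top\mathbf x+p$ on $\mathbb R^2$ ($R\in\mathbb S^2$, $\mathbf r\in\mathbb R^2$, $p\in\mathbb R$) is identified with its coefficient matrix $\begin{pmatrix}p&\mathbf r^\top\\ \mathbf r&R\end{pmatrix}\in\mathbb S^3$. Let $B=(\tfrac12,2)$, and let $\mathcal N_B\subset\mathbb S^3$ be the cone of (coefficient matrices of) quadratics $q$ with $q\ge0$ on $\mathcal G$ and $q(B)=0$. Its dual cone is $\mathcal N_B^*=\{Y\in\mathbb S^3: Y\bullet Q\ge0\ \ \forall Q\in\mathcal N_B\}$. Define $z_B=(1,\tfrac12,2)^\top$ and $$M_1(t)=\begin{pmatrix}0&0&-1\\ 0&0&-\tfrac12\\ -1&-\tfrac12&-(t+2)\end{pmatrix}.$$ Define $$\mathcal D_1=\{\lambda_-M_1(\tfrac12)+\lambda_+M_1(2)\mid\lambda_-,\lambda_+\ge0\},$$ $$\mathcal D_2=\left\{\begin{pmatrix}y_0&y_1&\tfrac12y_0\\ y_1&y_2&\tfrac12y_1\\ \tfrac12y_0&\tfrac12y_1&\tfrac14y_0\end{pmatrix}\ \middle|\ y_0,y_1,y_2\in\mathbb R,\ \begin{pmatrix}y_0&y_1\\ y_1&y_2\end{pmatrix}\succeq0,\ \tfrac52y_1-y_2-y_0\ge0\right\},$$ and let $\mathcal D_3$ be the set of matrices $$\begin{pmatrix}y_1+\tfrac12y_0&y_2+\tfrac12y_1+\tfrac14y_0&y_0\\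 y_2+\tfrac12y_1+\tfrac14y_0&y_3+\tfrac12y_2+\tfrac14y_1+\tfrac18y_0&y_1+\tfrac12y_0\\ y_0&y_1+\tfrac12y_0&0\end{pmatrix}$$ with $y_0,y_1,y_2,y_3\in\mathbb R$ satisfying $$\begin{pmatrix}y_1-\tfrac12y_0&y_2-\tfrac12y_1\\ y_2-\tfrac12y_1&y_3-\tfrac12y_2\end{pmatrix}\succeq0,\qquad \begin{pmatrix}2y_0-y_1&2y_1-y_2\\ 2y_1-y_2&2y_2-y_3\end{pmatrix}\succeq0.$$ *)

(* Defs.v *)
From mathcomp Require Import all_boot all_order all_algebra.
From mathcomp Require Import all_classical all_reals all_analysis.

Set Implicit Arguments.
Unset Strict Implicit.
Unset Printing Implicit Defensive.

Import Order.TTheory GRing.Theory Num.Theory.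
Import numFieldNormedType.Exports.

Local Open Scope classical_set_scope.
Local Open Scope ring_scope.

Definition mx_of_rows (R : realType) (m n : nat) (s : seq (seq R)) :
    'M[R]_(m, n) :=
  \matrix_(i < m, j < n) nth 0 (nth [::] s i) j.

Definition psd (R : realType) (n : nat) (A : 'M[R]_n) : Prop :=
  A \is symmetricmx /\ forall v : 'cV[R]_n, 0 <= (v^T *m A *m v) 0 0.

Definition frob (R : realType) (n : nat) (U V : 'M[R]_n) : R := \tr (U *m V).

(* The dual is taken inside the space of symmetric matrices. *)
Definition dual_cone (R : realType) (n : nat) (K : set 'M[R]_n) :
    set 'M[R]_n :=
  [set Y | Y \is symmetricmx /\ forall Q, K Q -> 0 <= frob Y Q].

Definition minkowski_sum (R : realType) (n : nat) (A C : set 'M[R]_n) :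
    set 'M[R]_n :=
  [set U + V | U in A & V in C].

Definition span1 (R : realType) (n : nat) (M : 'M[R]_n) : set 'M[R]_n :=
  range (fun l : R => l *: M).

(* Since the symmetric matrices form a closed subspace, it does not matter that
   the hull is computed in the space of all matrices. *)
Definition closed_convex_hull (R : realType) (n : nat) (A : set 'M[R]_n) :
    set 'M[R]_n :=
  smallest (fun C : set 'M[R]_n => closed C /\ convex_set C) A.

(* C is the projection of a set described by finitely many linear matrix
   inequalities in Y and in auxiliary real variables u. As psd includes
   symmetry, a block may also impose linear equations. *)
Definition semidefinite_extended_formulation (R : realType) (n : nat)
    (C : set 'M[R]_n) : Prop :=
  exists (m k : nat) (s : 'I_k -> nat)
    (A : forall i, 'M[R]_(s i))
    (F : forall i, {linear 'M[R]_n -> 'M[R]_(s i)})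
    (H : forall i, {linear 'rV[R]_m -> 'M[R]_(s i)}),
    C = [set Y | exists u : 'rV[R]_m, forall i, psd (A i + F i Y + H i u)].

Definition quadratic (R : realType) (p : R) (r : 'cV[R]_2) (S : 'M[R]_2)
    (x : 'cV[R]_2) : R :=
  (x^T *m S *m x) 0 0 + 2 * (r^T *m x) 0 0 + p.

Definition bordered (R : realType) (p : R) (r : 'cV[R]_2) (S : 'M[R]_2) :
    'M[R]_3 :=
  block_mx p%:M r^T r S.

Definition lift1 (R : realType) (x : 'cV[R]_2) : 'cV[R]_3 := col_mx 1%:M x.

Definition Cbar (R : realType) (D : set 'cV[R]_2) : set 'M[R]_3 :=
  closed_convex_hull [set lift1 x *m (lift1 x)^T | x in D].

Definition G (R : realType) : set 'cV[R]_2 :=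
  [set x | [/\ 1 / 2 <= x 0 0 <= 2, 1 / 2 <= x 1 0 <= 2 & x 0 0 * x 1 0 <= 1]].
Arguments G : clear implicits.

Definition pt_B (R : realType) : 'cV[R]_2 :=
  mx_of_rows 2 1 [:: [:: 1 / 2]; [:: 2]].

Definition N_B (R : realType) : set 'M[R]_3 :=
  [set Q | exists (p : R) (r : 'cV[R]_2) (S : 'M[R]_2),
    [/\ S \is symmetricmx, Q = bordered p r S,
        forall x, G R x -> 0 <= quadratic p r S x
      & quadratic p r S (pt_B R) = 0]].
Arguments N_B : clear implicits.

Definition z_B (R : realType) : 'cV[R]_3 :=
  mx_of_rows 3 1 [:: [:: 1]; [:: 1 / 2]; [:: 2]].

Definition M_1 (R : realType) (t : R) : 'M[R]_3 :=
  mx_of_rows 3 3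
    [:: [:: 0; 0; -1]; [:: 0; 0; - (1 / 2)]; [:: -1; - (1 / 2); - (t + 2)]].

Definition D_1 (R : realType) : set 'M[R]_3 :=
  [set Y | exists lm lp : R,
    [/\ 0 <= lm, 0 <= lp & Y = lm *: M_1 (1 / 2 : R) + lp *: M_1 2]].
Arguments D_1 : clear implicits.

Definition D_2 (R : realType) : set 'M[R]_3 :=
  [set Y | exists y0 y1 y2 : R,
    [/\ psd (mx_of_rows 2 2 [:: [:: y0; y1]; [:: y1; y2]]),
        0 <= 5 / 2 * y1 - y2 - y0
      & Y = mx_of_rows 3 3
          [:: [:: y0; y1; 1 / 2 * y0];
              [:: y1; y2; 1 / 2 * y1];
              [:: 1 / 2 * y0; 1 / 2 * y1; 1 / 4 * y0]]]].
Arguments D_2 : clear implicits.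

Definition D_3 (R : realType) : set 'M[R]_3 :=
  [set Y | exists y0 y1 y2 y3 : R,
    [/\ psd (mx_of_rows 2 2
          [:: [:: y1 - 1 / 2 * y0; y2 - 1 / 2 * y1];
              [:: y2 - 1 / 2 * y1; y3 - 1 / 2 * y2]]),
        psd (mx_of_rows 2 2
          [:: [:: 2 * y0 - y1; 2 * y1 - y2];
              [:: 2 * y1 - y2; 2 * y2 - y3]])
      & Y = mx_of_rows 3 3
          [:: [:: y1 + 1 / 2 * y0; y2 + 1 / 2 * y1 + 1 / 4 * y0; y0];
              [:: y2 + 1 / 2 * y1 + 1 / 4 * y0;
                  y3 + 1 / 2 * y2 + 1 / 4 * y1 + 1 / 8 * y0;
                  y1 + 1 / 2 * y0];
              [:: y0; y1 + 1 / 2 * y0; 0]]]].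
Arguments D_3 : clear implicits.

(* Main.v *)
Require Import Defs.
From HB Require Import structures.
From mathcomp Require Import all_boot all_order all_algebra.
From mathcomp Require Import all_classical all_reals all_analysis.
From mathcomp Require Import ring lra.

(** Let A = (1/2, 1/2) and C = (2, 1/2) be the other two corners of G.

    Dual cone of N_B.  A quadratic vanishing at B restricts to a line through B
    as t * (al + be * t), so it is nonnegative on G as soon as it is so on the
    edges AB and AC and on the arc xy = 1.  On AB it is (2 - y) times a linear
    function, on AC it is a quadratic, and on the arc it is (s - 1/2) / s^2 times
    a cubic; D_1, D_2 and D_3 are the moment cones dual to nonnegativity of these
    three polynomials (Markov-Lukacs).  The sum of the cones is closed because
    (x - 1/2) + (2 - y) is strictly positive for all three conditions, so a
    nearest point exists and separation applies.

    Hull.  If Y is positive semidefinite and satisfies both dual conditions but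
    is not in the hull, minimise Y . q over the quadratics q that are nonnegative
    on G, normalised by W . q = 1 with W interior.  At a minimiser r, of value
    m < 0, the matrix Y - m W is positive definite, nonnegative on all q
    nonnegative on G, and zero on r.  If the zeros of r in G lay on a line l = 0,
    then l^2 <= ep + k r on G for every ep > 0 and some k, contradicting
    (Y - m W) . l^2 > 0.  So r has three noncollinear zeros in G, and a case
    analysis of their positions forces r(B) = 0 or r(C) = 0, whence Y . r >= 0, a contradiction. *)

Set Implicit Arguments.
Unset Strict Implicit.
Unset Printing Implicit Defensive.

Import Order.TTheory GRing.Theory Num.Theory.
Import numFieldNormedType.Exports.

Local Open Scope classical_set_scope.
Local Open Scope ring_scope.

(** * Local behaviour of quadratics that are nonnegative on G *)

Section QuadraticsOnG.
Context {R : realFieldType}.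

(* The coefficient matrix is [[p, d, e], [d, a, b], [e, b, c]]. *)
Definition qv (p d e a b c x y : R) : R :=
  p + 2 * d * x + 2 * e * y + a * x ^+ 2 + 2 * b * (x * y) + c * y ^+ 2.

Definition inG (x y : R) : Prop :=
  [/\ 1 / 2 <= x <= 2, 1 / 2 <= y <= 2 & x * y <= 1].

Definition nonnegG (p d e a b c : R) : Prop :=
  forall x y, inG x y -> 0 <= qv p d e a b c x y.

(** If [al] were negative, then at some [t] no larger than [- al / (2 * L)] the second-order term
    would be at most half of [- al * t]. This one-sided test replaces differentiation and limits
    over an ordered field. *)
Lemma first_order_ge0 (al dl K : R) (k : R -> R) : 0 < dl ->
  (forall t, 0 < t < dl -> k t <= K) ->
  (forall t, 0 < t < dl -> 0 <= al * t + k t * t ^+ 2) -> 0 <= al.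
Proof.
move=> dl0 kK H; rewrite leNgt; apply/negP => al0.
pose L := `|K| + 1.
have L0 : 0 < L by rewrite ltr_wpDl.
have KL : K <= L by rewrite (le_trans (ler_norm K)) // lerDl.
pose t := Num.min (dl / 2) (- al / (2 * L)).
have t0 : 0 < t.
  by rewrite lt_min divr_gt0 //= divr_gt0 ?oppr_gt0 // mulr_gt0.
have tdl : t < dl by rewrite gt_min; apply/orP; left; lra.
have tL : t * (2 * L) <= - al by rewrite -ler_pdivlMr ?mulr_gt0 // ge_min lexx orbT.
have tt : 0 < t < dl by rewrite t0 tdl.
have /= := H t tt; have := kK t tt => h1 h2.
have h3 : k t * t ^+ 2 <= L * t ^+ 2 by rewrite ler_wpM2r ?sqr_ge0 // (le_trans h1).
nra.
Qed.

Lemma inG_nbhs (x0 y0 : R) : 1 / 2 < x0 -> 1 / 2 < y0 -> x0 * y0 < 1 ->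
  exists2 dl, 0 < dl & forall h k, `|h| <= dl -> `|k| <= dl -> inG (x0 + h) (y0 + k).
Proof.
move=> hx hy hxy.
(* The product of the coordinates grows by at most [dl * (x0 + y0 + dl)], hence by at most [5 * dl],
   as [x0] and [y0] are at most 2 and [dl] at most 1. *)
pose dl := Num.min (x0 - 1 / 2) (Num.min (y0 - 1 / 2) ((1 - x0 * y0) / 8)).
have d1 : dl <= x0 - 1 / 2 by rewrite ge_min lexx.
have d2 : dl <= y0 - 1 / 2 by rewrite ge_min; apply/orP; right; rewrite ge_min lexx.
have d3 : dl <= (1 - x0 * y0) / 8.
  by rewrite ge_min; apply/orP; right; rewrite ge_min lexx orbT.
have dl0 : 0 < dl by rewrite !lt_min; apply/and3P; split; lra.
exists dl => // h k; rewrite !ler_norml => /andP[h1 h2] /andP[k1 k2].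
have x2 : x0 <= 2 by nra.
have y2 : y0 <= 2 by nra.
have H : (x0 + h) * (y0 + k) <= 1.
  have : h * y0 <= dl * y0 by rewrite ler_wpM2r //; lra.
  have : k * x0 <= dl * x0 by rewrite ler_wpM2r //; lra.
  have : h * k <= dl * dl by nra.
  have : dl <= 1 by nra.
  nra.
have X : 1 / 2 <= x0 + h by lra.
have Y : 1 / 2 <= y0 + k by lra.
by split => //; apply/andP; split => //; nra.
Qed.

Lemma qvD (p d e a b c x y h k : R) :
  qv p d e a b c (x + h) (y + k) =
  qv p d e a b c x y + 2 * (d + a * x + b * y) * h + 2 * (e + b * x + c * y) * k
  + (a * h ^+ 2 + 2 * b * (h * k) + c * k ^+ 2).
Proof. by rewrite /qv; ring. Qed.

Definition psd2 (a b c : R) : Prop :=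
  forall u v, 0 <= a * u ^+ 2 + 2 * b * (u * v) + c * v ^+ 2.

Lemma psd2_disc (a b c : R) : psd2 a b c -> [/\ 0 <= a, 0 <= c & b ^+ 2 <= a * c].
Proof.
move=> P.
have a0 : 0 <= a by have := P 1 0; lra.
have c0 : 0 <= c by have := P 0 1; lra.
split => //.
have [a1|a1] := eqVneq a 0.
  (* For [a = 0] this vector gives the form the value [- (c + 2) * b ^+ 4], which forces [b = 0]. *)
  have := P (- (c + 1) * b) (b ^+ 2); rewrite a1 mul0r.
  rewrite (_ : _ + _ + _ = - ((c + 2) * (b ^+ 2) ^+ 2)); last by ring.
  rewrite oppr_ge0 pmulr_rle0; last by lra.
  have := sqr_ge0 (b ^+ 2) => h1 h2.
  have /eqP : (b ^+ 2) ^+ 2 = 0 by lra.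
  by rewrite expf_eq0 /= => /eqP ->; rewrite mul0r.
have := P (- b) a; have a2 : 0 < a by rewrite lt_def a1.
rewrite (_ : _ + _ + _ = a * (a * c - b ^+ 2)); last by ring.
by rewrite pmulr_rge0 // subr_ge0.
Qed.

(** An interior zero is a minimum: the gradient vanishes and the Hessian is positive semidefinite,
    so the quadratic equals its second-order part there. *)
Lemma interior_zero (p d e a b c x0 y0 : R) :
  nonnegG p d e a b c ->
  1 / 2 < x0 -> 1 / 2 < y0 -> x0 * y0 < 1 -> qv p d e a b c x0 y0 = 0 ->
  [/\ 0 <= a, 0 <= c, b ^+ 2 <= a * c &
    forall x y, qv p d e a b c x y =
      a * (x - x0) ^+ 2 + 2 * b * ((x - x0) * (y - y0)) + c * (y - y0) ^+ 2].
Proof.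
move=> q0 hx hy hxy z0.
have [dl dl0 dlG] := inG_nbhs hx hy hxy.
have P h k : `|h| <= dl -> `|k| <= dl ->
   0 <= 2 * (d + a * x0 + b * y0) * h + 2 * (e + b * x0 + c * y0) * k
  + (a * h ^+ 2 + 2 * b * (h * k) + c * k ^+ 2).
  by move=> h1 k1; have := q0 _ _ (dlG h k h1 k1); rewrite qvD z0 add0r.
(* Adding the inequalities at opposite increments cancels the linear terms. *)
have Q h k : `|h| <= dl -> `|k| <= dl -> 0 <= a * h ^+ 2 + 2 * b * (h * k) + c * k ^+ 2.
  move=> h1 k1; have := P h k h1 k1; have := P (- h) (- k).
  by rewrite !normrN => /(_ h1 k1); lra.
have Q' : psd2 a b c.
  move=> h k.
  (* By homogeneity it is enough to test the form on vectors shrunk by [dl / M] into the box. *)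
  pose M := `|h| + `|k| + 1.
  have M0 : 0 < M by rewrite ltr_wpDl // addr_ge0.
  have n z : `|z| <= M -> `|dl / M * z| <= dl.
    move=> zM; rewrite normrM (@gtr0_norm _ (dl / M)) ?divr_gt0 //.
    by rewrite -mulrA ger_pMr // ler_pdivrMl ?mulr1.
  have hM : `|h| <= M by rewrite /M -addrA lerDl addr_ge0.
  have kM : `|k| <= M by rewrite /M addrAC lerDr addr_ge0.
  have := Q _ _ (n h hM) (n k kM).
  rewrite (_ : _ + _ + _ = (dl / M) ^+ 2 * (a * h ^+ 2 + 2 * b * (h * k) + c * k ^+ 2));
    last by ring.
  by rewrite pmulr_rge0 // exprn_gt0 // divr_gt0.
have [a0 c0 bac] := psd2_disc Q'.
have tn t : 0 < t < dl -> `|t| <= dl by case/andP => t0 td; rewrite gtr0_norm // ltW.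
have n0 : `|0 : R| <= dl by rewrite normr0 ltW.
have g1 : d + a * x0 + b * y0 = 0.
  apply/eqP; rewrite eq_le; apply/andP; split.
    suff: 0 <= - (2 * (d + a * x0 + b * y0)) by lra.
    apply: (@first_order_ge0 _ dl a (fun=> a)) => // t tt.
    have := P (- t) 0; rewrite normrN => /(_ (tn _ tt) n0); lra.
  suff: 0 <= 2 * (d + a * x0 + b * y0) by lra.
  apply: (@first_order_ge0 _ dl a (fun=> a)) => // t tt.
  have := P t 0 (tn _ tt) n0; lra.
have g2 : e + b * x0 + c * y0 = 0.
  apply/eqP; rewrite eq_le; apply/andP; split.
    suff: 0 <= - (2 * (e + b * x0 + c * y0)) by lra.
    apply: (@first_order_ge0 _ dl c (fun=> c)) => // t tt.
    have := P 0 (- t) n0; rewrite normrN => /(_ (tn _ tt)); lra.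
  suff: 0 <= 2 * (e + b * x0 + c * y0) by lra.
  apply: (@first_order_ge0 _ dl c (fun=> c)) => // t tt.
  have := P 0 t n0 (tn _ tt); lra.
split => // x y.
rewrite -[in LHS](subrKC x0 x) -[in LHS](subrKC y0 y) qvD z0 g1 g2; ring.
Qed.
End QuadraticsOnG.

(** * Zeros on the edges and on the arc xy = 1 *)

Section BoundaryZeros.
Context {R : realFieldType}.

Lemma qvC (p d e a b c x y : R) : qv p d e a b c x y = qv p e d c b a y x.
Proof. by rewrite /qv; ring. Qed.

Lemma inGC (x y : R) : inG x y -> inG y x.
Proof. by case=> h1 h2 h3; split => //; rewrite mulrC. Qed.

(** With two distinct zeros the polynomial is [c * ((y - y1) * (y - y2))]; its sign at the midpoint
    forces [c <= 0], against positivity at 2. *)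
Lemma edge_zero_unique (p e c y1 y2 : R) :
  (forall y, 1 / 2 <= y <= 2 -> 0 <= p + 2 * e * y + c * y ^+ 2) ->
  0 < p + 2 * e * 2 + c * 2 ^+ 2 ->
  1 / 2 <= y1 <= 2 -> 1 / 2 <= y2 <= 2 ->
  p + 2 * e * y1 + c * y1 ^+ 2 = 0 -> p + 2 * e * y2 + c * y2 ^+ 2 = 0 -> y1 = y2.
Proof.
move=> f0 fB /andP[h1 h2] /andP[k1 k2] z1 z2; apply/eqP/negP => /negP y12.
have E : 2 * e = - c * (y1 + y2).
  have : (y1 - y2) * (2 * e + c * (y1 + y2)) = 0 by lra.
  by move/eqP; rewrite mulf_eq0 subr_eq0 (negbTE y12) /= => /eqP; lra.
have P : p = c * (y1 * y2) by have := z1; rewrite E; lra.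
have F y : p + 2 * e * y + c * y ^+ 2 = c * ((y - y1) * (y - y2)).
  by rewrite E P; ring.
have := f0 ((y1 + y2) / 2); rewrite F.
rewrite (_ : _ * (_ * _) = - c * ((y1 - y2) / 2) ^+ 2); last by field.
rewrite pmulr_lge0; last first.
  by rewrite exprn_even_gt0 //= mulf_neq0 ?invr_eq0 ?subr_eq0 //; lra.
have -> : 1 / 2 <= (y1 + y2) / 2 <= 2 by apply/andP; split; lra.
move=> /(_ isT) c0; move: fB; rewrite F ltNge => /negP; apply.
have : 0 <= (2 - y1) * (2 - y2) by rewrite mulr_ge0; lra.
nra.
Qed.

Lemma qv_arc (p d e a b c u : R) : u != 0 ->
  u ^+ 2 * qv p d e a b c u u^-1 =
  a * u ^+ 4 + 2 * d * u ^+ 3 + (p + 2 * b) * u ^+ 2 + 2 * e * u + c.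
Proof. by move=> u0; rewrite /qv; field. Qed.

Lemma inG_arc (u : R) : 1 / 2 <= u <= 2 -> inG u u^-1.
Proof.
move=> /andP[h1 h2]; have u0 : 0 < u by lra.
split; [by rewrite h1 | | by rewrite mulfV ?gt_eqF].
by rewrite -(mul1r u^-1) ler_pdivlMr // ler_pdivrMr //; apply/andP; split; lra.
Qed.

Lemma quartic_zero_deriv (a4 a3 a2 a1 a0 s : R) :
  let g u := a4 * u ^+ 4 + a3 * u ^+ 3 + a2 * u ^+ 2 + a1 * u + a0 in
  (forall u, 1 / 2 <= u <= 2 -> 0 <= g u) -> 1 / 2 < s < 2 -> g s = 0 ->
  4 * a4 * s ^+ 3 + 3 * a3 * s ^+ 2 + 2 * a2 * s + a1 = 0.
Proof.
move=> g g0 /andP[s1 s2] gs.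
set g' := (X in X = 0).
(* [k] is the second-order Taylor remainder of [g] at [s] divided by [h ^+ 2], and [K] bounds it for
   steps of size at most 1. *)
pose k h := (6 * a4 * s ^+ 2 + 3 * a3 * s + a2) + (4 * a4 * s + a3) * h + a4 * h ^+ 2.
pose K := `|6 * a4 * s ^+ 2 + 3 * a3 * s + a2| + `|4 * a4 * s + a3| + `|a4|.
have kK h : `|h| <= 1 -> k h <= K.
  move=> h1; rewrite /k /K !lerD //; first exact: ler_norm.
    by rewrite (le_trans (ler_norm _)) // normrM ler_piMr.
  by rewrite (le_trans (ler_norm _)) // normrM ler_piMr // normrX exprn_ile1.
have T h : g (s + h) = g' * h + k h * h ^+ 2.
  by rewrite -[RHS]add0r -gs /g /g' /k; ring.
pose dl := Num.min 1 (Num.min (s - 1 / 2) (2 - s)).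
have dl0 : 0 < dl by rewrite !lt_min; apply/and3P; split; lra.
have d1 : dl <= 1 by rewrite ge_min lexx.
have d2 : dl <= s - 1 / 2 by rewrite ge_min; apply/orP; right; rewrite ge_min lexx.
have d3 : dl <= 2 - s by rewrite ge_min; apply/orP; right; rewrite ge_min lexx orbT.
apply/eqP; rewrite eq_le; apply/andP; split.
  rewrite -oppr_ge0; apply: (@first_order_ge0 _ _ dl K (fun h => k (- h))) => //.
    by move=> t /andP[t0 td]; apply: kK; rewrite normrN gtr0_norm //; lra.
  move=> t /andP[t0 td]; have : 1 / 2 <= s + (- t) <= 2 by apply/andP; split; lra.
  by move=> /g0; rewrite T sqrrN mulrN mulNr.
apply: (@first_order_ge0 _ _ dl K k) => //.
  by move=> t /andP[t0 td]; apply: kK; rewrite gtr0_norm //; lra.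
move=> t /andP[t0 td]; have : 1 / 2 <= s + t <= 2 by apply/andP; split; lra.
by move=> /g0; rewrite T.
Qed.

(** The conclusion lists the coefficients of [a4] times the square of [(u - s) * (u - t)]. The
    difference of the two quartics is a cubic with double zeros at [s] and [t], hence zero. *)
Lemma quartic_two_double_zeros (a4 a3 a2 a1 a0 s t : R) : s != t ->
  a4 * s ^+ 4 + a3 * s ^+ 3 + a2 * s ^+ 2 + a1 * s + a0 = 0 ->
  a4 * t ^+ 4 + a3 * t ^+ 3 + a2 * t ^+ 2 + a1 * t + a0 = 0 ->
  4 * a4 * s ^+ 3 + 3 * a3 * s ^+ 2 + 2 * a2 * s + a1 = 0 ->
  4 * a4 * t ^+ 3 + 3 * a3 * t ^+ 2 + 2 * a2 * t + a1 = 0 ->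
  [/\ a3 = - 2 * a4 * (s + t), a2 = a4 * ((s + t) ^+ 2 + 2 * (s * t)),
      a1 = - 2 * a4 * (s * t) * (s + t) & a0 = a4 * (s * t) ^+ 2].
Proof.
move=> st gs gt ds dt.
pose h3 := a3 + 2 * a4 * (s + t).
pose h2 := a2 - a4 * ((s + t) ^+ 2 + 2 * (s * t)).
pose h1 := a1 + 2 * a4 * (s * t) * (s + t).
pose h0 := a0 - a4 * (s * t) ^+ 2.
have Hs : h3 * s ^+ 3 + h2 * s ^+ 2 + h1 * s + h0 = 0.
  by rewrite -[RHS]gs /h3 /h2 /h1 /h0; ring.
have Ht : h3 * t ^+ 3 + h2 * t ^+ 2 + h1 * t + h0 = 0.
  by rewrite -[RHS]gt /h3 /h2 /h1 /h0; ring.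
have Ds : 3 * h3 * s ^+ 2 + 2 * h2 * s + h1 = 0.
  by rewrite -[RHS]ds /h3 /h2 /h1 /h0; ring.
have Dt : 3 * h3 * t ^+ 2 + 2 * h2 * t + h1 = 0.
  by rewrite -[RHS]dt /h3 /h2 /h1 /h0; ring.
have ts : t - s != 0 by rewrite subr_eq0 eq_sym.
have h30 : h3 = 0.
  have : (t - s) ^+ 3 * h3 = 0.
    (* Hermite interpolation: the leading coefficient of a cubic in terms of its values and slopes
       at two nodes. *)
    transitivity (- 2 * (h3 * t ^+ 3 + h2 * t ^+ 2 + h1 * t + h0)
       + 2 * (h3 * s ^+ 3 + h2 * s ^+ 2 + h1 * s + h0)
       + (t - s) * ((3 * h3 * s ^+ 2 + 2 * h2 * s + h1)
                + (3 * h3 * t ^+ 2 + 2 * h2 * t + h1))); first by ring.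
    by rewrite Hs Ht Ds Dt; ring.
  by move/eqP; rewrite mulf_eq0 expf_eq0 /= (negbTE ts) => /eqP.
have h20 : h2 = 0.
  have : (t - s) * h2 = 0 by move: Ds Dt; rewrite h30; lra.
  by move/eqP; rewrite mulf_eq0 (negbTE ts) => /eqP.
have h10 : h1 = 0 by move: Ds; rewrite h30 h20; lra.
have h00 : h0 = 0 by move: Hs; rewrite h30 h20 h10; lra.
move: h30 h20 h10 h00; rewrite /h3 /h2 /h1 /h0 => e3 e2 e1 e0; split.
- by apply/eqP; rewrite -subr_eq0; apply/eqP; rewrite -e3; ring.
- by apply/eqP; rewrite -subr_eq0; apply/eqP; rewrite -e2; ring.
- by apply/eqP; rewrite -subr_eq0; apply/eqP; rewrite -e1; ring.
- by apply/eqP; rewrite -subr_eq0; apply/eqP; rewrite -e0; ring.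
Qed.

(** Both arc zeros are double zeros of the quartic on the arc, so [q] is [a] times the square of the
    chord form plus [lm * (1 - x * y)]. A zero off the chord would need [lm < 0], but then [q] is
    negative where the line of the chord, continued past [t], runs through [x * y < 1] inside G. *)
Lemma two_arc_zeros (p d e a b c s t : R) :
  nonnegG p d e a b c ->
  0 < qv p d e a b c (1 / 2) 2 ->
  1 / 2 < s -> s < t -> t < 2 ->
  qv p d e a b c s s^-1 = 0 -> qv p d e a b c t t^-1 = 0 ->
  forall x y, inG x y -> qv p d e a b c x y = 0 -> x + s * t * y - (s + t) = 0.
Proof.
move=> q0 qB s1 st t2 zs zt x y [_ _ xy1] z.
have arc u : 1 / 2 <= u <= 2 ->
    0 <= a * u ^+ 4 + 2 * d * u ^+ 3 + (p + 2 * b) * u ^+ 2 + 2 * e * u + c.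
  move=> hu; rewrite -qv_arc; last by case/andP: hu => h _; rewrite gt_eqF //; lra.
  by rewrite mulr_ge0 ?sqr_ge0 // q0 //; apply: inG_arc.
have sN0 : s != 0 by rewrite gt_eqF //; lra.
have tN0 : t != 0 by rewrite gt_eqF //; lra.
have gs : a * s ^+ 4 + 2 * d * s ^+ 3 + (p + 2 * b) * s ^+ 2 + 2 * e * s + c = 0.
  by rewrite -qv_arc // zs mulr0.
have gt : a * t ^+ 4 + 2 * d * t ^+ 3 + (p + 2 * b) * t ^+ 2 + 2 * e * t + c = 0.
  by rewrite -qv_arc // zt mulr0.
have hs : 1 / 2 < s < 2 by apply/andP; split; lra.
have ht : 1 / 2 < t < 2 by apply/andP; split; lra.
have ds := quartic_zero_deriv arc hs gs.
have dt := quartic_zero_deriv arc ht gt.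
have stN : s != t by rewrite lt_eqF.
have [E3 E2 E1 E0] := quartic_two_double_zeros stN gs gt ds dt.
pose lm := p - a * (s + t) ^+ 2.
have D : forall x y, qv p d e a b c x y =
    a * (x + s * t * y - (s + t)) ^+ 2 + lm * (1 - x * y).
  move=> x' y'; rewrite /qv.
  have -> : 2 * b = a * ((s + t) ^+ 2 + 2 * (s * t)) - p by rewrite -E2; ring.
  rewrite E3 E1 E0 /lm; ring.
have a0 : 0 < a.
  move: qB; rewrite D (_ : 1 - 1 / 2 * 2 = 0); last by field.
  rewrite mulr0 addr0 => h; rewrite ltNge; apply/negP => a0; move: h.
  by apply/negP; rewrite -leNgt mulr_le0_ge0 // sqr_ge0.
apply/eqP/negP => /negP lN.
have l2 : 0 < (x + s * t * y - (s + t)) ^+ 2 by rewrite exprn_even_gt0.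
have lm0 : lm < 0.
  rewrite ltNge; apply/negP => lm0; move: z; rewrite D => z.
  have : 0 <= lm * (1 - x * y) by rewrite mulr_ge0 // subr_ge0.
  have : 0 < a * (x + s * t * y - (s + t)) ^+ 2 by rewrite mulr_gt0.
  lra.
have st0 : 0 < s * t by rewrite mulr_gt0; lra.
(* Small enough that the point of the chord line with abscissa [t + ep] keeps its ordinate above
   1/2. *)
pose ep := (2 - t) / 4.
have ep0 : 0 < ep by rewrite /ep; lra.
have yE : s * t * ((s - ep) / (s * t)) = s - ep by field; rewrite sN0 tN0.
have y1 : 1 / 2 <= (s - ep) / (s * t) by rewrite ler_pdivlMr // /ep; nra.
have y2 : (s - ep) / (s * t) <= 2 by rewrite ler_pdivrMr //; nra.
have xy : (t + ep) * ((s - ep) / (s * t)) < 1.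
  by rewrite mulrA ltr_pdivrMr // mul1r; nra.
have Gp : inG (t + ep) ((s - ep) / (s * t)).
  by split; [|rewrite y1|exact: ltW]; apply/andP; split => //; rewrite /ep; lra.
have := q0 _ _ Gp; rewrite D yE (_ : t + ep + (s - ep) - (s + t) = 0); last by ring.
by rewrite expr0n /= mulr0 add0r nmulr_rge0 // subr_le0 leNgt xy.
Qed.

End BoundaryZeros.

(** * Quadratics with noncollinear zeros in G *)

Section ZeroSets.
Context {R : realFieldType}.

(** An isotropic vector of a semidefinite form lies in its kernel: each squared component of the
    image is a multiple of the form minus a nonnegative multiple of the discriminant. *)
Lemma psd2_isotropic (a b c h k : R) : 0 <= a -> 0 <= c -> b ^+ 2 <= a * c ->
  a * h ^+ 2 + 2 * b * (h * k) + c * k ^+ 2 = 0 ->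
  a * h + b * k = 0 /\ b * h + c * k = 0.
Proof.
move=> a0 c0 bac z.
have k2 := sqr_ge0 k; have h2 := sqr_ge0 h.
have D : 0 <= a * c - b ^+ 2 by rewrite subr_ge0.
have H1 : (a * h + b * k) ^+ 2 = a * (a * h ^+ 2 + 2 * b * (h * k) + c * k ^+ 2)
   - (a * c - b ^+ 2) * k ^+ 2 by ring.
have H2 : (b * h + c * k) ^+ 2 = c * (a * h ^+ 2 + 2 * b * (h * k) + c * k ^+ 2)
   - (a * c - b ^+ 2) * h ^+ 2 by ring.
rewrite z mulr0 sub0r in H1; rewrite z mulr0 sub0r in H2.
split; apply/eqP; rewrite -sqrf_eq0; apply/eqP/le_anti; rewrite sqr_ge0 andbT.
  by rewrite H1 oppr_le0 mulr_ge0.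
by rewrite H2 oppr_le0 mulr_ge0.
Qed.

Lemma psd2_null (a b c h k h' k' : R) : 0 <= a -> 0 <= c -> b ^+ 2 <= a * c ->
  a * h ^+ 2 + 2 * b * (h * k) + c * k ^+ 2 = 0 ->
  a * h' ^+ 2 + 2 * b * (h' * k') + c * k' ^+ 2 = 0 ->
  h * k' - h' * k != 0 -> [/\ a = 0, b = 0 & c = 0].
Proof.
move=> a0 c0 bac z z' D.
have [e1 e2] := psd2_isotropic a0 c0 bac z.
have [e1' e2'] := psd2_isotropic a0 c0 bac z'.
have K x : (h * k' - h' * k) * x = 0 -> x = 0.
  by move/eqP; rewrite mulf_eq0 (negbTE D) /= => /eqP.
split; apply: K.
- rewrite (_ : _ * a = (a * h + b * k) * k' - (a * h' + b * k') * k); last by ring.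
  by rewrite e1 e1'; ring.
- rewrite (_ : _ * b = (b * h + c * k) * k' - (b * h' + c * k') * k); last by ring.
  by rewrite e2 e2'; ring.
- rewrite (_ : _ * c = (b * h' + c * k') * h - (b * h + c * k) * h'); last by ring.
  by rewrite e2 e2'; ring.
Qed.

Section Zeros.
Variables p d e a b c : R.
Let q := qv p d e a b c.
Hypothesis q0 : forall x y, inG x y -> 0 <= q x y.
Hypothesis qB : 0 < q (1 / 2) 2.
Hypothesis qC : 0 < q 2 (1 / 2).
(** The zeros in G lie on no common line; the case [l = m = 0] says that there is a zero at all. *)
Hypothesis NC : forall l m n : R, [|| l != 0, m != 0 | n != 0] ->
  exists x y, [/\ inG x y, q x y = 0 & l * x + m * y + n != 0].

(** Around an interior zero [q] is a semidefinite form. Noncollinearity supplies zeros in two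
    independent directions from that point, so the form vanishes, against [qB]. *)
Lemma no_interior_zero (x0 y0 : R) : 1 / 2 < x0 -> 1 / 2 < y0 -> x0 * y0 < 1 -> q x0 y0 <> 0.
Proof.
move=> hx hy hxy z.
have [a0 c0 bac E] := interior_zero q0 hx hy hxy z.
have [|x1 [y1 [_ z1 l1]]] := NC (l := 1) (m := 0) (n := - x0).
  by rewrite oner_neq0.
have [|x2 [y2 [_ z2 l2]]] :=
  NC (l := y1 - y0) (m := - (x1 - x0)) (n := (x1 - x0) * y0 - (y1 - y0) * x0).
  apply/or3P/Or32; rewrite oppr_eq0; apply: contraNneq l1 => l1.
  by rewrite mul1r mul0r addr0 l1.
move: z1 z2; rewrite /q !E => z1 z2.
have [|A B C] := psd2_null a0 c0 bac z1 z2; last first.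
  by move: qB; rewrite /q E A B C !mul0r mulr0 mul0r !addr0 ltxx.
apply: contraNneq l2 => h; rewrite -oppr_eq0 -h; apply/eqP; ring.
Qed.

Lemma zero_cases (x y : R) : inG x y -> q x y = 0 ->
  [\/ x = 1 / 2, y = 1 / 2 | [/\ 1 / 2 < x, x < 2 & y = x^-1]].
Proof.
move=> [/andP[x1 x2] /andP[y1 y2] xy] z.
have [->|xN] := eqVneq x (1 / 2); first by apply: Or31.
have [->|yN] := eqVneq y (1 / 2); first by apply: Or32.
have x3 : 1 / 2 < x by rewrite lt_def xN.
have y3 : 1 / 2 < y by rewrite lt_def yN.
have xx : x < 2 by nra.
apply: Or33; split => //.
have [xy1|xy1] := eqVneq (x * y) 1.
  by apply: (mulfI (x := x)); rewrite ?mulfV // gt_eqF //; lra.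
by case: (@no_interior_zero x y) => //; rewrite lt_neqAle xy1.
Qed.

Lemma zero_AB (y1 y2 : R) : inG (1 / 2) y1 -> inG (1 / 2) y2 ->
  q (1 / 2) y1 = 0 -> q (1 / 2) y2 = 0 -> y1 = y2.
Proof.
move=> [_ h1 _] [_ h2 _] z1 z2.
have E y : q (1 / 2) y = (p + d + a / 4) + 2 * (e + b / 2) * y + c * y ^+ 2.
  by rewrite /q /qv; field.
apply: (@edge_zero_unique _ (p + d + a / 4) (e + b / 2) c) => //.
- move=> y hy; rewrite -E; apply: q0; split => //; case/andP: hy => *;
  try (apply/andP; split); lra.
- by rewrite -E.
- by rewrite -E.
- by rewrite -E.
Qed.

Lemma zero_AC (x1 x2 : R) : inG x1 (1 / 2) -> inG x2 (1 / 2) ->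
  q x1 (1 / 2) = 0 -> q x2 (1 / 2) = 0 -> x1 = x2.
Proof.
move=> [h1 _ _] [h2 _ _] z1 z2.
have E y : q y (1 / 2) = (p + e + c / 4) + 2 * (d + b / 2) * y + a * y ^+ 2.
  by rewrite /q /qv; field.
apply: (@edge_zero_unique _ (p + e + c / 4) (d + b / 2) a) => //.
- move=> y hy; rewrite -E; apply: q0; split => //; case/andP: hy => *;
  try (apply/andP; split); lra.
- by rewrite -E.
- by rewrite -E.
- by rewrite -E.
Qed.

(** Two arc zeros would confine all zeros to their chord. *)
Lemma zero_arc (s t : R) : 1 / 2 < s -> s < 2 -> 1 / 2 < t -> t < 2 ->
  q s s^-1 = 0 -> q t t^-1 = 0 -> s = t.
Proof.
have H s' t' : 1 / 2 < s' -> s' < t' -> t' < 2 ->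
   q s' s'^-1 = 0 -> q t' t'^-1 = 0 -> False.
  move=> s1 st t2 zs zt.
  have [|x [y [Gxy z /eqP l]]] := NC (l := 1) (m := s' * t') (n := - (s' + t')).
    by rewrite oner_neq0.
  by apply: l; rewrite mul1r; apply: (two_arc_zeros q0 qB).
move=> s1 s2 t1 t2 zs zt.
case: (ltgtP s t) => // st; first by case: (H s t).
by case: (H t s).
Qed.

(** The zeros on AB and AC are critical points along their edges, which makes [q], up to the factor
    [(u * v) ^+ 2], equal to [k] times the square of the form of the line joining them plus
    [mu * ((x - 1 / 2) * (y - 1 / 2))]. A point of the segment shows [mu >= 0]; at the arc zero both
    terms then vanish, so that zero lies on the line. *)
Lemma no_triangle (y1 x2 s : R) : 1 / 2 < y1 < 2 -> 1 / 2 < x2 < 2 ->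
  1 / 2 < s < 2 -> q (1 / 2) y1 = 0 -> q x2 (1 / 2) = 0 -> q s s^-1 = 0 ->
  (y1 - 1 / 2) * (s - 1 / 2) + (x2 - 1 / 2) * (s^-1 - 1 / 2) = (y1 - 1 / 2) * (x2 - 1 / 2).
Proof.
move=> hy hx hs z1 z2 z3.
have EB y : q (1 / 2) y = 0 * y ^+ 4 + 0 * y ^+ 3 + c * y ^+ 2 + (2 * e + b) * y + (p + d + a / 4).
  by rewrite /q /qv; field.
have EC x : q x (1 / 2) = 0 * x ^+ 4 + 0 * x ^+ 3 + a * x ^+ 2 + (2 * d + b) * x + (p + e + c / 4).
  by rewrite /q /qv; field.
have D1 : 2 * c * y1 + (2 * e + b) = 0.
  rewrite -(@quartic_zero_deriv _ 0 0 c (2 * e + b) (p + d + a / 4) y1) //; first by ring.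
    by move=> y /andP[? ?]; rewrite -EB; apply: q0; split; try (apply/andP; split); lra.
  by rewrite -EB.
have D2 : 2 * a * x2 + (2 * d + b) = 0.
  rewrite -(@quartic_zero_deriv _ 0 0 a (2 * d + b) (p + e + c / 4) x2) //; first by ring.
    by move=> y /andP[? ?]; rewrite -EC; apply: q0; split; try (apply/andP; split); lra.
  by rewrite -EC.
move: hy hx hs => /andP[hy1 hy2] /andP[hx1 hx2] /andP[hs1 hs2].
pose u := y1 - 1 / 2; pose v := x2 - 1 / 2; rewrite -/u -/v.
have u0 : 0 < u by rewrite subr_gt0.
have v0 : 0 < v by rewrite subr_gt0.
have Ee : 2 * e = - 2 * c * y1 - b by lra.
have Ed : 2 * d = - 2 * a * x2 - b by lra.
have Ep1 : p = - d - a / 4 - c * y1 ^+ 2 - (2 * e + b) * y1 by move: z1; rewrite EB; lra.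
have Ep2 : p = - e - c / 4 - a * x2 ^+ 2 - (2 * d + b) * x2 by move: z2; rewrite EC; lra.
(* Compares the two expressions of [p] coming from the zero on AB and the zero on AC. *)
have k12 : a * v ^+ 2 = c * u ^+ 2.
  have Ed' : d = - a * x2 - b / 2 by lra.
  have Ee' : e = - c * y1 - b / 2 by lra.
  by move: Ep1; rewrite Ep2 Ed' Ee' /u /v; lra.
pose k := a * v ^+ 2.
have N x y : q x y * (u * v) ^+ 2 = k * (u * (x - 1 / 2) + v * (y - 1 / 2) - u * v) ^+ 2
   + (2 * b * (u * v) ^+ 2 - 2 * k * (u * v)) * ((x - 1 / 2) * (y - 1 / 2)).
  have Q : q x y = a * (x - 1 / 2) ^+ 2 + c * (y - 1 / 2) ^+ 2 - 2 * a * v * (x - 1 / 2)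
     - 2 * c * u * (y - 1 / 2) + 2 * b * ((x - 1 / 2) * (y - 1 / 2)) + a * v ^+ 2.
    rewrite /q /qv Ee Ed Ep2 Ed.
    have -> : e = - c * y1 - b / 2 by lra.
    by rewrite /u /v; field.
  rewrite Q.
  have -> : (a * (x - 1 / 2) ^+ 2 + c * (y - 1 / 2) ^+ 2 - 2 * a * v * (x - 1 / 2)
     - 2 * c * u * (y - 1 / 2) + 2 * b * ((x - 1 / 2) * (y - 1 / 2)) + a * v ^+ 2) * (u * v) ^+ 2 =
     k * u ^+ 2 * (x - 1 / 2) ^+ 2 + (c * u ^+ 2) * v ^+ 2 * (y - 1 / 2) ^+ 2
     - 2 * k * v * u ^+ 2 * (x - 1 / 2) - 2 * (c * u ^+ 2) * u * v ^+ 2 * (y - 1 / 2)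
     + 2 * b * (u * v) ^+ 2 * ((x - 1 / 2) * (y - 1 / 2)) + k * (u * v) ^+ 2 by rewrite /k; ring.
  by rewrite -k12 -/k; ring.
set mu := (2 * b * (u * v) ^+ 2 - 2 * k * (u * v)) in N.
have uv0 : 0 < (u * v) ^+ 2 by rewrite exprn_gt0 // mulr_gt0.
have k0 : 0 < k.
  have : 0 < q 2 (1 / 2) * (u * v) ^+ 2 by rewrite mulr_gt0.
  rewrite N subrr !mulr0 !addr0 => h; rewrite ltNge; apply/negP => a0; move: h.
  by apply/negP; rewrite -leNgt mulr_le0_ge0 // sqr_ge0.
have y10 : 0 < y1 by lra.
(* [tau] marks a point of the segment near its end on AB. As [v] is at most 3/2, the bound
   [(1 / 2 + tau * v) * y1] on the product of its coordinates is at most 1. *)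
pose tau := (2 - y1) / (3 * y1).
have t0 : 0 < tau by rewrite divr_gt0 // ?mulr_gt0 //; lra.
have t1 : tau < 1 by rewrite ltr_pdivrMr ?mulr_gt0 //; lra.
have ty : tau * y1 = (2 - y1) / 3 by rewrite /tau; field; rewrite gt_eqF.
have mu0 : 0 <= mu.
  have G0 : inG (1 / 2 + tau * v) (1 / 2 + u * (1 - tau)).
    have a1 : tau * v <= tau * (3 / 2) by rewrite ler_pM2l // /v; lra.
    have a2 : 0 <= tau * v by rewrite mulr_ge0 ?ltW.
    have a3 : 0 <= tau * u by rewrite mulr_ge0 ?ltW.
    have a4 : tau * u <= u by rewrite ger_pMl // ltW.
    have a5 : 1 / 2 + u * (1 - tau) <= y1 by rewrite /u in a3 *; lra.
    split; [apply/andP; split| apply/andP; split| ]; try lra.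
    apply: (@le_trans _ _ ((1 / 2 + tau * v) * y1)).
      by rewrite ler_wpM2l //; lra.
    have : tau * v * y1 <= tau * (3 / 2) * y1 by rewrite ler_pM2r.
    lra.
  have : 0 <= q (1 / 2 + tau * v) (1 / 2 + u * (1 - tau)) * (u * v) ^+ 2.
    by rewrite mulr_ge0 ?q0 // ltW.
  rewrite N (_ : _ - u * v = 0); last by ring.
  rewrite expr0n /= mulr0 add0r pmulr_lge0 //.
  rewrite (_ : (_ - _) * _ = (tau * v) * (u * (1 - tau))); last by ring.
  by apply: mulr_gt0; apply: mulr_gt0 => //; lra.
have sV : 1 / 2 < s^-1 by rewrite -(mul1r s^-1) ltr_pdivlMr; lra.
have := N s s^-1; rewrite z3 mul0r => /esym/eqP.
rewrite paddr_eq0; last 2 first.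
- by rewrite mulr_ge0 ?sqr_ge0 // ltW.
- by rewrite mulr_ge0 // mulr_ge0; lra.
by case/andP => /eqP + _; move/eqP; rewrite mulf_eq0 (gt_eqF k0) /= sqrf_eq0 subr_eq0 => /eqP.
Qed.

(** Take a third zero off the line through the two given ones. On AB or on the arc it would coincide
    with one of them by uniqueness; on AC it would be collinear with them by [no_triangle]. *)
Lemma no_arc_zero_with_AB_zero (y1 s : R) : inG (1 / 2) y1 -> 1 / 2 < s < 2 ->
  1 / 2 < y1 -> q (1 / 2) y1 = 0 -> q s s^-1 = 0 -> False.
Proof.
move=> G1 hs hy z1 zs; have /andP[s1 s2] := hs.
have [|x [y [G2 z2 l]]] := NC (l := y1 - s^-1) (m := s - 1 / 2)
    (n := - (y1 - s^-1) / 2 - (s - 1 / 2) * y1).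
  by apply/or3P/Or32; rewrite subr_eq0 gt_eqF.
have y12 : y1 < 2.
  case: G1 => _ /andP[_ h] _; rewrite lt_neqAle h andbT.
  by apply/eqP => E; move: z1 qB; rewrite E => ->; rewrite ltxx.
case: (zero_cases G2 z2) => [x12|y0|[x1 x2 xy]].
- rewrite x12 in G2 z2 l; move: l; rewrite (zero_AB G2 G1 z2 z1) => /eqP; apply; field.
  by rewrite gt_eqF //; lra.
- rewrite y0 in G2 z2 l.
  have x2 : x < 2.
    case: G2 => /andP[_ h] _ _; rewrite lt_neqAle h andbT.
    by apply/eqP => E; move: z2 qC; rewrite E => ->; rewrite ltxx.
  have [x12|xN] := eqVneq x (1 / 2).
    rewrite x12 in G2 z2; have := zero_AB G1 G2 z1 z2; lra.
  have x1 : 1 / 2 < x by case: G2 => /andP[h _] _ _; rewrite lt_def xN.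
  have := @no_triangle y1 x s; rewrite hy y12 x1 x2 hs => /(_ isT isT isT z1 z2 zs) E.
  move/eqP: l; apply; lra.
- rewrite xy in z2 G2 l; have sx := zero_arc x1 x2 s1 s2 z2 zs.
  move: l; rewrite sx => /eqP; apply; field; rewrite gt_eqF //; lra.
Qed.
End Zeros.

Lemma noncollinear_zeros_absurd (p d e a b c : R) :
  nonnegG p d e a b c ->
  0 < qv p d e a b c (1 / 2) 2 -> 0 < qv p d e a b c 2 (1 / 2) ->
  (forall l m n : R, [|| l != 0, m != 0 | n != 0] ->
    exists x y, [/\ inG x y, qv p d e a b c x y = 0 & l * x + m * y + n != 0]) ->
  False.
Proof.
move=> q0 qB qC NC.
(* Reflection in the diagonal preserves G and exchanges B with C, so results about AB transfer to
   AC. *)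
have q0' x y : inG x y -> 0 <= qv p e d c b a x y.
  by move=> Gxy; rewrite -qvC q0 //; apply: inGC.
have qB' : 0 < qv p e d c b a (1 / 2) 2 by rewrite -qvC.
have qC' : 0 < qv p e d c b a 2 (1 / 2) by rewrite -qvC.
have NC' l m n : [|| l != 0, m != 0 | n != 0] ->
    exists x y, [/\ inG x y, qv p e d c b a x y = 0 & l * x + m * y + n != 0].
  rewrite orbCA => /NC[x [y [Gxy z h]]]; exists y, x; split.
  - exact: inGC.
  - by rewrite -qvC.
  - by rewrite [l * y + _]addrC.
have zc := zero_cases q0 qB NC.
have arcAB y s : inG (1 / 2) y -> 1 / 2 < y -> qv p d e a b c (1 / 2) y = 0 ->
    1 / 2 < s < 2 -> qv p d e a b c s s^-1 = 0 -> False.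
  by move=> Gy hy zy hs; apply: (no_arc_zero_with_AB_zero q0 qB qC NC Gy).
have arcAC x s : inG x (1 / 2) -> 1 / 2 < x -> qv p d e a b c x (1 / 2) = 0 ->
    1 / 2 < s < 2 -> qv p d e a b c s s^-1 = 0 -> False.
  move=> Gx hx; rewrite !(qvC p d) => zx hs zs.
  have := no_arc_zero_with_AB_zero q0' qB' qC' NC' (s := s^-1) (inGC Gx) _ hx zx.
  have sV : 1 / 2 < s^-1 < 2.
    case/andP: hs => s1 s2.
    by rewrite -(mul1r s^-1) ltr_pdivlMr ?ltr_pdivrMr; try (apply/andP; split); lra.
  by rewrite invrK => /(_ sV zs).
(* A zero off the line through A and the arc zero lies on an edge and differs from A, or is a second
   arc zero; all cases are excluded. *)
have arc s : 1 / 2 < s < 2 -> qv p d e a b c s s^-1 = 0 -> False.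
  move=> hs zs; have /andP[s1 s2] := hs.
  have [|x [y [Gxy z l]]] := NC (s^-1 - 1 / 2) (- (s - 1 / 2))
      (- (s^-1 - 1 / 2) / 2 + (s - 1 / 2) / 2).
    by apply/or3P/Or32; rewrite oppr_eq0 subr_eq0 gt_eqF.
  case: (zc _ _ Gxy z) => [x12|y12|[x1 x2 xy]].
  - rewrite x12 in Gxy z l.
    have [y12|yN] := eqVneq y (1 / 2).
      by move: l; rewrite y12 => /eqP; apply; field; rewrite gt_eqF //; lra.
    by apply: (arcAB y s) => //; case: Gxy => _ /andP[? _] _; rewrite lt_def yN.
  - rewrite y12 in Gxy z l.
    have [x12|xN] := eqVneq x (1 / 2).
      by move: l; rewrite x12 => /eqP; apply; field; rewrite gt_eqF //; lra.
    by apply: (arcAC x s) => //; case: Gxy => /andP[? _] _ _; rewrite lt_def xN.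
  - rewrite xy in z l; move: l.
    rewrite (zero_arc q0 qB NC x1 x2 s1 s2 z zs) => /eqP; apply.
    by field; rewrite gt_eqF //; lra.
(* With the arc excluded, a zero off the line AC lies on AB, and a zero off the line AB lies on AC.
   Uniqueness on each edge leaves no zero off the line joining these two. *)
have [|x1 [y1 [G1 z1 l1]]] := NC 0 1 (- (1 / 2)); first by rewrite oner_neq0 orbT.
case: (zc _ _ G1 z1) => [x12|y12|[h1 h2 xy]]; last 2 first.
- by move: l1; rewrite y12 => /eqP; apply; ring.
- by apply: (arc x1); rewrite ?h1 // -xy.
have [|x2 [y2 [G2 z2 l2]]] := NC 1 0 (- (1 / 2)); first by rewrite oner_neq0.
case: (zc _ _ G2 z2) => [x22|y22|[h1 h2 xy]].
- by move: l2; rewrite x22 => /eqP; apply; ring.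
- rewrite x12 in G1 z1 l1; rewrite y22 in G2 z2 l2.
  have hy : y1 != 1 / 2 by apply: contraNneq l1 => ->; apply/eqP; ring.
  have [|x [y [G3 z3 l3]]] := NC (y1 - 1 / 2) (x2 - 1 / 2)
      (- (y1 - 1 / 2) / 2 - (x2 - 1 / 2) * y1); first by rewrite subr_eq0 hy.
  case: (zc _ _ G3 z3) => [x32|y32|[h1 h2 xy]].
  + rewrite x32 in G3 z3 l3; move: l3.
    by rewrite (zero_AB q0 qB G3 G1 z3 z1) => /eqP; apply; field.
  + rewrite y32 in G3 z3 l3; move: l3.
    by rewrite (zero_AC q0 qC G3 G2 z3 z2) => /eqP; apply; field.
  + by apply: (arc x); rewrite ?h1 // -xy.
- by apply: (arc x2); rewrite ?h1 // -xy.
Qed.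


End ZeroSets.

(** * Moment inequalities on [1/2, 2], and nonnegativity on G from boundary data *)

Section MomentInequalities.
Context {R : realFieldType}.

(* Any quadratic is its chord over [1/2, 2] plus a multiple of (s - 1/2)(2 - s);
   a concave one is handled by this identity, a convex one by Jensen. *)
Lemma quadratic_moment_ge0 (u0 u1 u2 y0 y1 y2 : R) :
  (forall s, 1 / 2 <= s <= 2 -> 0 <= u0 + u1 * s + u2 * s ^+ 2) ->
  psd2 y0 y1 y2 -> 0 <= 5 / 2 * y1 - y2 - y0 ->
  0 <= u0 * y0 + u1 * y1 + u2 * y2.
Proof.
move=> up /psd2_disc[y00 y20 D] h.
(* Combining [y1 ^+ 2 <= y0 * y2] with the linear condition places the mean [y1 / y0] in [1/2, 2],
   stated without division because [y0] may be 0. *)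
have D2 : (y1 - 2 * y0) * (y1 - y0 / 2) <= 0.
  have : y0 * y2 <= y0 * (5 / 2 * y1 - y0) by rewrite ler_wpM2l //; lra.
  lra.
have [l1 l2] : y0 / 2 <= y1 /\ y1 <= 2 * y0.
  split; rewrite leNgt; apply/negP => k; move: D2; apply/negP; rewrite -ltNge.
    by rewrite nmulr_rgt0; lra.
  by rewrite pmulr_rgt0; lra.
have [c|c] := leP u2 0.
  have A : 0 <= u0 + u1 * (1 / 2) + u2 * (1 / 2) ^+ 2 by apply: up; apply/andP; split; lra.
  have C : 0 <= u0 + u1 * 2 + u2 * 2 ^+ 2 by apply: up; apply/andP; split; lra.
  have -> : u0 * y0 + u1 * y1 + u2 * y2 =
    2 / 3 * ((2 * y0 - y1) * (u0 + u1 * (1 / 2) + u2 * (1 / 2) ^+ 2)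
             + (y1 - y0 / 2) * (u0 + u1 * 2 + u2 * 2 ^+ 2))
    + - u2 * (5 / 2 * y1 - y2 - y0) by field.
  apply: addr_ge0; apply: mulr_ge0; try lra.
  by apply: addr_ge0; apply: mulr_ge0 => //; lra.
have [y01|y01] := eqVneq y0 0.
  have -> : y1 = 0 by lra.
  by rewrite y01 !mulr0 !add0r mulr_ge0 // ltW.
have y0p : 0 < y0 by rewrite lt_def y01.
have m : 1 / 2 <= y1 / y0 <= 2.
  by rewrite ler_pdivlMr // ler_pdivrMr //; apply/andP; split; lra.
have U := up _ m.
rewrite -(pmulr_rge0 _ y0p).
have -> : y0 * (u0 * y0 + u1 * y1 + u2 * y2) =
   y0 ^+ 2 * (u0 + u1 * (y1 / y0) + u2 * (y1 / y0) ^+ 2) + u2 * (y0 * y2 - y1 ^+ 2).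
  by field.
by apply: addr_ge0; apply: mulr_ge0; rewrite ?sqr_ge0 ?(ltW c) // subr_ge0.
Qed.

(* Markov-Lukacs: once the minimum of the cubic is 0, it factors as an end
   factor times a nonnegative quadratic, or as a square times a linear form. *)
Lemma cubic_zero_moment_ge0 (k0 k1 k2 k3 s0 y0 y1 y2 y3 : R) :
  (forall s, 1 / 2 <= s <= 2 -> 0 <= k0 + k1 * s + k2 * s ^+ 2 + k3 * s ^+ 3) ->
  1 / 2 <= s0 <= 2 -> k0 + k1 * s0 + k2 * s0 ^+ 2 + k3 * s0 ^+ 3 = 0 ->
  psd2 (y1 - 1 / 2 * y0) (y2 - 1 / 2 * y1) (y3 - 1 / 2 * y2) ->
  psd2 (2 * y0 - y1) (2 * y1 - y2) (2 * y2 - y3) ->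
  0 <= k0 * y0 + k1 * y1 + k2 * y2 + k3 * y3.
Proof.
move=> kp /andP[s1 s2] z P1 P2.
(* Coefficients of the quotient of the cubic by [s - s0]. *)
pose u2 := k3; pose u1 := k2 + k3 * s0; pose u0 := k1 + u1 * s0.
have F s : k0 + k1 * s + k2 * s ^+ 2 + k3 * s ^+ 3 = (s - s0) * (u0 + u1 * s + u2 * s ^+ 2).
  by rewrite -[LHS]subr0 -z /u0 /u1 /u2; ring.
have K0 : k0 = - s0 * u0 by rewrite -[LHS]subr0 -z /u0 /u1; ring.
have T t : u0 + u1 * (s0 + t) + u2 * (s0 + t) ^+ 2 =
   (u0 + u1 * s0 + u2 * s0 ^+ 2) + t * (u1 + 2 * u2 * s0 + u2 * t) by ring.
have [E|N1] := eqVneq s0 (1 / 2).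
  have up s : 1 / 2 <= s <= 2 -> 0 <= u0 + u1 * s + u2 * s ^+ 2.
    move=> /andP[h1 h2]; have [Es|Ns] := eqVneq s (1 / 2); last first.
      have := kp s; rewrite h1 h2 F => /(_ isT); rewrite pmulr_rge0 // E subr_gt0.
      by rewrite lt_def Ns.
    rewrite Es -E.
    apply: (@first_order_ge0 _ _ 1 (`|u1 + 2 * u2 * s0| + `|u2|)
      (fun t => u1 + 2 * u2 * s0 + u2 * t)) => // t /andP[t0 t1].
      rewrite lerD ?ler_norm // (le_trans (ler_norm _)) // normrM ler_piMr //.
      by rewrite gtr0_norm // ltW.
    have := kp (s0 + t); rewrite F T.
    have -> : 1 / 2 <= s0 + t <= 2 by apply/andP; split; lra.
    by move=> /(_ isT); lra.
  have := quadratic_moment_ge0 up P1.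
  (* This pairs the moments with [(2 - s) * (s - 1 / 2) ^+ 2], the linear condition required of the
     moments weighted by [s - 1 / 2]. *)
  have := P2 (- 1 / 2) 1 => h.
  have -> : 0 <= 5 / 2 * (y2 - 1 / 2 * y1) - (y3 - 1 / 2 * y2) - (y1 - 1 / 2 * y0) by lra.
  by move/(_ isT); rewrite K0 /u0 /u1 /u2 E; lra.
have [E|N2] := eqVneq s0 2.
  have up s : 1 / 2 <= s <= 2 -> 0 <= (- u0) + (- u1) * s + (- u2) * s ^+ 2.
    move=> /andP[h1 h2]; rewrite !mulNr -!opprD oppr_ge0.
    have [Es|Ns] := eqVneq s 2; last first.
      have := kp s; rewrite h1 h2 F => /(_ isT); rewrite nmulr_rge0 // E subr_lt0.
      by rewrite lt_neqAle Ns.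
    rewrite Es -E -oppr_ge0.
    apply: (@first_order_ge0 _ _ 1 (`|u1 + 2 * u2 * s0| + `|u2|)
      (fun t => u1 + 2 * u2 * s0 - u2 * t)) => // t /andP[t0 t1].
      rewrite lerD ?ler_norm // (le_trans (ler_norm _)) // normrN normrM ler_piMr //.
      by rewrite gtr0_norm // ltW.
    have := kp (s0 - t); rewrite F T.
    have -> : 1 / 2 <= s0 - t <= 2 by apply/andP; split; lra.
    by move=> /(_ isT); lra.
  have := quadratic_moment_ge0 up P2.
  have := P1 (- 2) 1 => h.
  have -> : 0 <= 5 / 2 * (2 * y1 - y2) - (2 * y2 - y3) - (2 * y0 - y1) by lra.
  by move/(_ isT); rewrite K0 /u0 /u1 /u2 E; lra.
have h1 : 1 / 2 < s0 by rewrite lt_def N1.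
have h2 : s0 < 2 by rewrite lt_neqAle N2.
have D : k1 + 2 * k2 * s0 + 3 * k3 * s0 ^+ 2 = 0.
  rewrite -(@quartic_zero_deriv _ 0 k3 k2 k1 k0 s0); first by ring.
  - by move=> u hu; have := kp _ hu; lra.
  - by rewrite h1.
  - by rewrite -[RHS]z; ring.
(* At an interior zero the cubic is [(s - s0) ^+ 2 * (m + k3 * s)]. *)
pose m := k2 + 2 * k3 * s0.
have K1 : k1 = - 2 * k2 * s0 - 3 * k3 * s0 ^+ 2 by lra.
have K0' : k0 = s0 ^+ 2 * m by rewrite K0 /u0 /u1 K1 /m; ring.
have F' s : k0 + k1 * s + k2 * s ^+ 2 + k3 * s ^+ 3 = (s - s0) ^+ 2 * (m + k3 * s).
  by rewrite K0' K1 /m; ring.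
have A : 0 <= m + k3 * (1 / 2).
  have hE : 1 / 2 <= ((1 / 2) : R) <= 2 by apply/andP; split; lra.
  have := kp _ hE; rewrite F' pmulr_rge0 //.
  by rewrite exprn_even_gt0 //= subr_eq0 eq_sym.
have C : 0 <= m + k3 * 2.
  have hE : 1 / 2 <= (2 : R) <= 2 by apply/andP; split; lra.
  have := kp _ hE; rewrite F' pmulr_rge0 //.
  by rewrite exprn_even_gt0 //= subr_eq0 eq_sym.
have := P1 (- s0) 1; have := P2 (- s0) 1.
set X2 := (X in 0 <= X -> _) => p2; set X1 := (X in 0 <= X -> _) => p1.
(* The linear factor is interpolated from its values at 1/2 and 2, with weights proportional to
   [2 - s] and [s - 1 / 2]; [X2] and [X1] are the moments of these weights times [(s - s0) ^+ 2]. *)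
have -> : k0 * y0 + k1 * y1 + k2 * y2 + k3 * y3 =
   2 / 3 * ((m + k3 * (1 / 2)) * X2 + (m + k3 * 2) * X1).
  by rewrite K0' K1 /m /X1 /X2; field.
by rewrite mulr_ge0 ?divr_ge0 // addr_ge0 // mulr_ge0.
Qed.

Lemma affine_between (al be t1 t2 : R) : t1 <= 1 -> 1 <= t2 ->
  0 <= al + be * t1 -> 0 <= al + be * t2 -> 0 <= al + be.
Proof. by move=> h1 h2 k1 k2; have [b0|b0] := leP 0 be; nra. Qed.

(* On a line through B the quadratic is t * (al + be * t), so its sign at an
   interior point is controlled by the boundary points of G on that line. *)
Lemma boundary_ge0 (p d e a b c : R) :
  qv p d e a b c (1 / 2) 2 = 0 ->
  2 * e + b + 4 * c <= 0 ->
  4 * (2 * e + b + 4 * c) <= 2 * d + a + 4 * b ->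
  (forall s, 1 / 2 <= s <= 2 -> 0 <= qv p d e a b c s (1 / 2)) ->
  (forall s, 1 / 2 <= s <= 2 -> 0 <= qv p d e a b c s s^-1) ->
  nonnegG p d e a b c.
Proof.
move=> qB g2 g1 hAC harc x y [/andP[x1 x2] /andP[y1 y2] xy].
pose X := x - 1 / 2; pose V := 2 - y.
pose al := X * (2 * d + a + 4 * b) - V * (2 * e + b + 4 * c).
pose be := a * X ^+ 2 - 2 * b * (X * V) + c * V ^+ 2.
have L t : qv p d e a b c (1 / 2 + t * X) (2 - t * V) = t * (al + be * t).
  by rewrite qvD qB /al /be; field.
have X0 : 0 <= X by rewrite subr_ge0.
have V0 : 0 <= V by rewrite subr_ge0.
(* This is [x * y <= 1] in coordinates centred at B. *)
have XV : 2 * X <= V * (1 / 2 + X) by rewrite /X /V; lra.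
have -> : qv p d e a b c x y = al + be.
  have := L 1; rewrite !mul1r mulr1 => <-; congr (qv _ _ _ _ _ _ _ _); rewrite /X /V; ring.
have [V00|VN] := eqVneq V 0.
  have X00 : X = 0 by rewrite V00 in XV; lra.
  by rewrite /al /be V00 X00; lra.
have Vp : 0 < V by rewrite lt_def VN.
have XleV : X <= V by rewrite /X in XV *; nra.
(* The parameter at which the ray from B reaches the line y = 1/2. *)
pose tE := 3 / 2 / V.
have tE1 : 1 <= tE by rewrite ler_pdivlMr // mul1r /V; lra.
have tEp : 0 < tE by lra.
have hE : 0 <= al + be * tE.
  have tX : tE * X <= 3 / 2 by rewrite /tE mulrAC ler_pdivrMr //; lra.
  have tX0 : 0 <= tE * X by rewrite mulr_ge0 // ltW.
  have : 0 <= qv p d e a b c (1 / 2 + tE * X) (1 / 2).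
    by apply: hAC; apply/andP; split; lra.
  have -> : qv p d e a b c (1 / 2 + tE * X) (1 / 2) = tE * (al + be * tE).
    by rewrite -L; congr (qv _ _ _ _ _ _ _ _); rewrite /tE; field.
  by rewrite pmulr_rge0.
(* The tangent to the arc at B has slope -4. A ray at least that steep is controlled by the slope
   [al] of [q] at B; a flatter one meets the arc again, at parameter [tH]. *)
have [st|fl] := leP (4 * X) V.
  have al0 : 0 <= al.
    have -> : al = X * (2 * d + a + 4 * b - 4 * (2 * e + b + 4 * c))
      + (V - 4 * X) * (- (2 * e + b + 4 * c)) by rewrite /al; ring.
    by rewrite addr_ge0 // mulr_ge0 //; lra.
  by apply: (@affine_between al be 0 tE) => //; rewrite mulr0 addr0.
have Xp : 0 < X by lra.
pose tH := 2 / V - 1 / (2 * X).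
have VX0 : 0 < 2 * (V * X) by rewrite !mulr_gt0.
have tHE : tH = (4 * X - V) / (2 * (V * X)) by rewrite /tH; field; rewrite !gt_eqF.
have tH0 : 0 < tH by rewrite tHE divr_gt0 //; lra.
have tH1 : tH <= 1 by rewrite tHE ler_pdivrMr // mul1r; lra.
have hH : 0 <= al + be * tH.
  have : 0 <= qv p d e a b c (2 * X / V) (2 * X / V)^-1.
    by apply: harc; rewrite ler_pdivlMr // ler_pdivrMr //; apply/andP; split; lra.
  have -> : qv p d e a b c (2 * X / V) (2 * X / V)^-1 = tH * (al + be * tH).
    by rewrite -L; congr (qv _ _ _ _ _ _ _ _); rewrite /tH; field; rewrite !gt_eqF.
  by rewrite pmulr_rge0.
exact: affine_between hH hE.
Qed.
End MomentInequalities.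

(** * Coordinates for symmetric matrices and quadratics *)

Section SymmetricMatrices.
Context {R : realType}.

Definition sym3 (p d e a b c : R) : 'M[R]_3 :=
  mx_of_rows 3 3 [:: [:: p; d; e]; [:: d; a; b]; [:: e; b; c]].

Lemma mx3P (A B : 'M[R]_3) :
  [/\ A 0 0 = B 0 0, A 0 1 = B 0 1 & A 0 ord_max = B 0 ord_max] ->
  [/\ A 1 0 = B 1 0, A 1 1 = B 1 1 & A 1 ord_max = B 1 ord_max] ->
  [/\ A ord_max 0 = B ord_max 0, A ord_max 1 = B ord_max 1
    & A ord_max ord_max = B ord_max ord_max] -> A = B.
Proof.
move=> [h1 h2 h3] [h4 h5 h6] [h7 h8 h9]; apply/matrixP => i j.
have E (k : 'I_3) : [\/ k = 0, k = 1 | k = ord_max].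
  case: k => [[|[|[|//]]] h]; [apply: Or31|apply: Or32|apply: Or33]; exact: val_inj.
by case: (E i) => ->; case: (E j) => ->.
Qed.

Lemma mx2P (A B : 'M[R]_2) :
  A 0 0 = B 0 0 -> A 0 1 = B 0 1 -> A 1 0 = B 1 0 -> A 1 1 = B 1 1 -> A = B.
Proof.
move=> h1 h2 h3 h4; apply/matrixP => i j.
have E (k : 'I_2) : k = 0 \/ k = 1.
  by case: k => [[|[|//]] h]; [left|right]; exact: val_inj.
by case: (E i) => ->; case: (E j) => ->.
Qed.

Lemma sum2 (V : nmodType) (F : 'I_2 -> V) : \sum_(i < 2) F i = F 0 + F 1.
Proof.
rewrite !big_ord_recl big_ord0 addr0; congr (F _ + F _); exact: val_inj.
Qed.

Lemma sum3 (V : nmodType) (F : 'I_3 -> V) : \sum_(i < 3) F i = F 0 + F 1 + F ord_max.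
Proof.
rewrite !big_ord_recl big_ord0 addr0 addrA; congr (F _ + F _ + F _); exact: val_inj.
Qed.

Lemma symmetricmxE n (A : 'M[R]_n) : A \is symmetricmx -> forall i j, A i j = A j i.
Proof. by move=> /is_hermitianmxP h i j; rewrite [in LHS]h expr0 scale1r !mxE. Qed.

Lemma symmetricmxP n (A : 'M[R]_n) : (forall i j, A i j = A j i) -> A \is symmetricmx.
Proof.
move=> h; apply/is_hermitianmxP; rewrite expr0 scale1r.
by apply/matrixP => i j; rewrite !mxE.
Qed.

Lemma sym3_symmetric p d e a b c : sym3 p d e a b c \is symmetricmx.
Proof. by apply: symmetricmxP => -[[|[|[|//]]] ?] [[|[|[|//]]] ?]; rewrite !mxE. Qed.

Lemma symmetric_sym3 (Y : 'M[R]_3) : Y \is symmetricmx ->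
  Y = sym3 (Y 0 0) (Y 0 1) (Y 0 ord_max) (Y 1 1) (Y 1 ord_max) (Y ord_max ord_max).
Proof.
by move=> /symmetricmxE h; apply: mx3P; split; rewrite [RHS]mxE /= // h.
Qed.

Lemma frob_sym3 (Y : 'M[R]_3) (p d e a b c : R) :
  frob Y (sym3 p d e a b c) =
  Y 0 0 * p + (Y 0 1 + Y 1 0) * d + (Y 0 ord_max + Y ord_max 0) * e + Y 1 1 * a
  + (Y 1 ord_max + Y ord_max 1) * b + Y ord_max ord_max * c.
Proof. by rewrite /frob /mxtrace sum3 !mxE !sum3 !mxE /=; ring. Qed.

Lemma bordered_sym3 (p : R) (r : 'cV[R]_2) (S : 'M[R]_2) : S \is symmetricmx ->
  bordered p r S = sym3 p (r 0 0) (r 1 0) (S 0 0) (S 0 1) (S 1 1).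
Proof.
move=> /symmetricmxE h.
have S2 (k l : 'I_2) : S k l = nth 0 (nth [::] [:: [:: S 0 0; S 0 1]; [:: S 0 1; S 1 1]] k) l.
  case: k l => [[|[|//]] ?] [[|[|//]] ?] /=; last 2 first.
  - by rewrite h; congr (S _ _); apply: val_inj.
  - by congr (S _ _); apply: val_inj.
  - by congr (S _ _); apply: val_inj.
  - by congr (S _ _); apply: val_inj.
have r2 (k : 'I_2) : r k 0 = nth 0 [:: r 0 0; r 1 0] k.
  by case: k => [[|[|//]] ?] /=; congr (r _ _); apply: val_inj.
apply/matrixP => i j; rewrite !mxE.
case: splitP => k hk; rewrite mxE; case: splitP => l hl; rewrite ?mxE hk hl ?ord1 //=.
- by rewrite r2; case: k {hk} => [[|[|//]] ?].
- by rewrite S2; case: k {hk} => [[|[|//]] ?].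
Qed.

Lemma quadratic_qv (p : R) (r : 'cV[R]_2) (S : 'M[R]_2) x : S \is symmetricmx ->
  quadratic p r S x = qv p (r 0 0) (r 1 0) (S 0 0) (S 0 1) (S 1 1) (x 0 0) (x 1 0).
Proof.
move=> /symmetricmxE h.
by rewrite /quadratic /qv !mxE !sum2 !mxE !sum2 !mxE (h 1 0); ring.
Qed.

Lemma lift1E (x : 'cV[R]_2) (i : 'I_3) :
  lift1 x i 0 = nth 0 [:: 1; x 0 0; x 1 0] i.
Proof.
rewrite mxE; case: splitP => k ->; rewrite ?mxE ?ord1 //=.
by case: k => [[|[|//]] ?] /=; congr (x _ _); apply: val_inj.
Qed.

Lemma lift1_sym3 (x : 'cV[R]_2) : lift1 x *m (lift1 x)^T =
  sym3 1 (x 0 0) (x 1 0) (x 0 0 ^+ 2) (x 0 0 * x 1 0) (x 1 0 ^+ 2).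
Proof.
by apply: mx3P; split; rewrite mxE big_ord1 [_^T _ _]mxE !lift1E [RHS]mxE /=; ring.
Qed.

Lemma frob_lift1 (x : 'cV[R]_2) p d e a b c :
  frob (lift1 x *m (lift1 x)^T) (sym3 p d e a b c) = qv p d e a b c (x 0 0) (x 1 0).
Proof. by rewrite lift1_sym3 frob_sym3 /qv !mxE /=; ring. Qed.

Definition vec2 (x y : R) : 'cV[R]_2 := mx_of_rows 2 1 [:: [:: x]; [:: y]].

Lemma G_inG (x : 'cV[R]_2) : G R x <-> inG (x 0 0) (x 1 0).
Proof. by []. Qed.

Lemma inG_vec2 (x y : R) : inG x y <-> G R (vec2 x y).
Proof. by rewrite G_inG !mxE. Qed.

Lemma N_B_sym3 (Q : 'M[R]_3) : N_B R Q <->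
  exists p d e a b c, [/\ Q = sym3 p d e a b c, nonnegG p d e a b c
    & qv p d e a b c (1 / 2) 2 = 0].
Proof.
split=> [[p [r [S [Ss -> q0 qB]]]]|[p [d [e [a [b [c [-> q0 qB]]]]]]]].
  exists p, (r 0 0), (r 1 0), (S 0 0), (S 0 1), (S 1 1); split.
  - exact: bordered_sym3.
  - move=> x y /inG_vec2 /q0; rewrite quadratic_qv // !mxE //.
  - by rewrite -qB quadratic_qv // !mxE.
pose r := vec2 d e; pose S : 'M[R]_2 := mx_of_rows 2 2 [:: [:: a; b]; [:: b; c]].
have Ss : S \is symmetricmx.
  by apply: symmetricmxP => -[[|[|//]] ?] [[|[|//]] ?]; rewrite !mxE.
exists p, r, S; split => //.
- by rewrite bordered_sym3 // !mxE.
- by move=> x /G_inG /q0; rewrite quadratic_qv // !mxE.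
- by rewrite quadratic_qv // !mxE.
Qed.

End SymmetricMatrices.

(** * Continuity of polynomial expressions and of the trace pairing *)

Section ContinuityTools.
Context {R : realType} {T : topologicalType}.
Implicit Types f g : T -> R.

Lemma continuous_add f g : continuous f -> continuous g -> continuous (fun x => f x + g x).
Proof. by move=> cf cg x; apply: (@continuousD _ _ _ f g); [exact: cf|exact: cg]. Qed.

Lemma continuous_opp f : continuous f -> continuous (fun x => - f x).
Proof. by move=> cf x; apply: (@continuousN _ _ _ f); exact: cf. Qed.

Lemma continuous_mul f g : continuous f -> continuous g -> continuous (fun x => f x * g x).
Proof. by move=> cf cg x; apply: (@continuousM _ _ f g); [exact: cf|exact: cg]. Qed.

Lemma continuous_frob n (f g : T -> 'M[R]_n) :
  (forall i j, continuous (fun t => f t i j)) ->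
  (forall i j, continuous (fun t => g t i j)) -> continuous (fun t => frob (f t) (g t)).
Proof.
move=> cf cg; rewrite /frob /mxtrace.
rewrite (_ : (fun _ => _) = fun t => \sum_i \sum_j f t i j * g t j i); last first.
  by apply/funext => t; apply: eq_bigr => i _; rewrite mxE.
apply: continuous_big => [|i _]; first exact: add_continuous.
apply: continuous_big => [|j _]; first exact: add_continuous.
exact: continuous_mul.
Qed.
End ContinuityTools.

Ltac continuity := lazymatch goal with
  | |- continuous (fun _ => ?c) => exact: cst_continuous
  | |- continuous (fun x => x) => by move=> ?; exact: cvg_id
  | |- continuous (fun x => @?f x + @?g x) => apply: (@continuous_add _ _ f g); continuity
  | |- continuous (fun x => @?f x * @?g x) => apply: (@continuous_mul _ _ f g); continuity
  | |- continuous (fun x => - @?f x) => apply: (@continuous_opp _ _ f); continuity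
  | |- _ => try by [exact: coord_continuous]
  end.

(** * Minima on compact sets, nearest points and closed convex hulls *)

Section ConvexHull.
Context {R : realType}.

Lemma continuous_mx (T : topologicalType) m n (f : T -> 'M[R]_(m, n)) :
  (forall i j, continuous (fun t => f t i j)) -> continuous f.
Proof.
move=> fc t; apply/cvg_ballP => e e0.
have H : \forall x \near t, forall i j, ball (f t i j) e (f x i j).
  apply: filter_forall => i; apply: filter_forall => j.
  by have /cvg_ballP := fc i j t; apply.
by apply: filterS H => x h; split.
Qed.

Lemma closed_ge0 (T : topologicalType) (h : T -> R) :
  continuous h -> closed [set t | 0 <= h t].
Proof. by move=> /continuous_closedP hc; have := hc _ (@closed_ge R 0); apply. Qed.

Lemma closed_forall (T : topologicalType) (I : Type) (f : I -> set T) :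
  (forall i, closed (f i)) -> closed [set t | forall i, f i t].
Proof.
move=> fc; rewrite (_ : mkset _ = \bigcap_i f i); first by apply: closed_bigI.
by apply/seteqP; split => [t h i _|t h i]; apply: h.
Qed.

(** Heine-Borel and the extreme value theorem for rows. Matrices and quadratics are later encoded as
    rows of coordinates in order to use it. *)
Lemma rV_min n (D : set 'rV[R]_n) (K : R) (h : 'rV[R]_n -> R) :
  closed D -> (forall u, D u -> forall i, `|u 0 i| <= K) -> D !=set0 -> continuous h ->
  exists2 c, D c & forall u, D u -> h c <= h u.
Proof.
move=> Dc DK D0 hc.
have Bc : compact [set u : 'rV[R]_n | forall i, u ord0 i \in `[- K, K]].
  apply: (@rV_compact _ _ (fun=> `[- K, K]%classic)) => i.
  exact: segment_compact.
have Dk : compact D.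
  apply: subclosed_compact Dc Bc _ => u Du i.
  by rewrite in_itv /= -ler_norml; apply: DK.
have [|c cD cmin] := EVT_min_rV D0 Dk (f := h); first exact: continuous_subspaceT.
by exists c; [rewrite inE in cD|move=> u Du; apply: cmin; rewrite inE].
Qed.

Lemma frobC n (U V : 'M[R]_n) : frob U V = frob V U.
Proof. exact: mxtrace_mulC. Qed.

Lemma frobDl n (U V W : 'M[R]_n) : frob (U + V) W = frob U W + frob V W.
Proof. by rewrite /frob mulmxDl linearD. Qed.

Lemma frobZl n (a : R) (U W : 'M[R]_n) : frob (a *: U) W = a * frob U W.
Proof. by rewrite /frob -scalemxAl linearZ. Qed.

Lemma frobNl n (U W : 'M[R]_n) : frob (- U) W = - frob U W.
Proof. by rewrite -scaleN1r frobZl mulN1r. Qed.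

Lemma frobBl n (U V W : 'M[R]_n) : frob (U - V) W = frob U W - frob V W.
Proof. by rewrite frobDl frobNl. Qed.

Lemma frobDr n (U V W : 'M[R]_n) : frob W (U + V) = frob W U + frob W V.
Proof. by rewrite frobC frobDl !(frobC W). Qed.

Lemma frobZr n (a : R) (U W : 'M[R]_n) : frob W (a *: U) = a * frob W U.
Proof. by rewrite frobC frobZl (frobC W). Qed.

Lemma frobBr n (U V W : 'M[R]_n) : frob W (U - V) = frob W U - frob W V.
Proof. by rewrite frobC frobBl !(frobC W). Qed.

Lemma frob_sqr n (N : 'M[R]_n) : N \is symmetricmx ->
  frob N N = \sum_i \sum_j N i j ^+ 2.
Proof.
move=> /symmetricmxE h; rewrite /frob /mxtrace; apply: eq_bigr => i _.
by rewrite mxE; apply: eq_bigr => j _; rewrite (h j i) expr2.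
Qed.

Lemma frob_sqr_gt0 n (N : 'M[R]_n) : N \is symmetricmx -> N != 0 -> 0 < frob N N.
Proof.
move=> Ns N1; rewrite ltNge; apply/negP => N0; move/negP: N1; apply.
rewrite frob_sqr // in N0.
have p i : true -> 0 <= \sum_j N i j ^+ 2 by move=> _; apply: sumr_ge0 => j _; exact: sqr_ge0.
have /eqP : \sum_i \sum_j N i j ^+ 2 = 0 by apply/le_anti; rewrite N0 sumr_ge0.
rewrite psumr_eq0 // => /allP h; apply/eqP/matrixP => i j.
have := h i (mem_index_enum i); rewrite /= psumr_eq0; last by move=> k _; exact: sqr_ge0.
move/allP => /(_ j (mem_index_enum j)) /=.
by rewrite sqrf_eq0 mxE => /eqP.
Qed.

(** The squared distance to [Y] cannot decrease along the segment from [P] towards [M], and its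
    slope at [P] is twice the pairing in the conclusion. *)
Lemma nearest_point_obtuse n (C : set 'M[R]_n) (Y P M : 'M[R]_n) :
  (forall t : R, 0 < t < 1 -> C (P + t *: (M - P))) ->
  (forall M, C M -> frob (P - Y) (P - Y) <= frob (M - Y) (M - Y)) ->
  0 <= frob (M - P) (P - Y).
Proof.
move=> Cc Pm; rewrite -(pmulr_rge0 _ (ltr0Sn R 1)).
apply: (@first_order_ge0 _ _ 1 (frob (M - P) (M - P)) (fun=> frob (M - P) (M - P))) => // t t01.
have := Pm _ (Cc t t01).
rewrite addrAC; move: (P - Y) (M - P) => N D.
rewrite frobDl !frobDr !frobZl !frobZr (frobC N D); lra.
Qed.

Lemma convex_setP (C : set 'M[R]_3) : convex_set C <->
  forall U V (t : R), C U -> C V -> 0 <= t <= 1 -> C (t *: U + (1 - t) *: V).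
Proof.
split => [h U V t CU CV t01|h U V l].
  pose l : {i01 R} := Itv01 (andP t01).1 (andP t01).2.
  by have := h U V l; rewrite !inE => /(_ CU CV).
by rewrite !inE => CU CV; apply: h => //; rewrite ge0 le1.
Qed.

Lemma Cbar_closed D : closed (Cbar (R := R) D).
Proof. by apply: closed_bigI => C [[]]. Qed.

Lemma Cbar_convex D (U V : 'M[R]_3) (t : R) : Cbar D U -> Cbar D V -> 0 <= t <= 1 ->
  Cbar D (t *: U + (1 - t) *: V).
Proof.
move=> CU CV t01 C [[Cc Cv] CD]; have /convex_setP := Cv; apply => //.
  exact: CU.
exact: CV.
Qed.

Lemma Cbar_lift D x : D x -> Cbar (R := R) D (lift1 x *m (lift1 x)^T).
Proof. by move=> Dx C [_]; apply; exists x. Qed.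

Lemma frob_continuous n (Q : 'M[R]_n) : continuous (fun M : 'M[R]_n => frob M Q).
Proof.
by apply: continuous_frob => i j; [exact: coord_continuous|exact: cst_continuous].
Qed.

(** A closed half-space is one of the closed convex sets intersected in the hull. *)
Lemma Cbar_halfspace D (Q : 'M[R]_3) (k : R) :
  (forall x, D x -> k <= frob (lift1 x *m (lift1 x)^T) Q) ->
  forall M, Cbar D M -> k <= frob M Q.
Proof.
move=> DQ M CM; apply: (CM [set M | k <= frob M Q]); split; last first.
  by move=> _ [x Dx <-]; exact: DQ.
split.
  rewrite (_ : (fun _ => _) = [set M | 0 <= frob M Q - k]).
    apply: closed_ge0 => N; apply: (@continuousB _ _ _ (fun M => frob M Q) (fun=> k));
      last exact: cst_continuous.
    exact: frob_continuous.
  by apply/seteqP; split => N /=; rewrite subr_ge0.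
apply/convex_setP => U V t hU hV /andP[t0 t1].
rewrite /= frobDl !frobZl.
have : t * k <= t * frob U Q by rewrite ler_wpM2l.
have : (1 - t) * k <= (1 - t) * frob V Q by rewrite ler_wpM2l // subr_ge0.
lra.
Qed.

End ConvexHull.

(** * The sum of the cones lies in the dual cone *)

Section Decomposition.
Context {R : realType}.

(** Subtracting the minimum over [1/2, 2] reduces to a cubic with a zero. The minimum contributes
    [f s0 * y0], and [y0 >= 0] because the leading entries of the two forms add up to
    [3 / 2 * y0]. *)
Lemma cubic_moment_ge0 (k0 k1 k2 k3 y0 y1 y2 y3 : R) :
  (forall s, 1 / 2 <= s <= 2 -> 0 <= k0 + k1 * s + k2 * s ^+ 2 + k3 * s ^+ 3) ->
  psd2 (y1 - 1 / 2 * y0) (y2 - 1 / 2 * y1) (y3 - 1 / 2 * y2) ->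
  psd2 (2 * y0 - y1) (2 * y1 - y2) (2 * y2 - y3) ->
  0 <= k0 * y0 + k1 * y1 + k2 * y2 + k3 * y3.
Proof.
move=> kp P1 P2.
pose f s : R := k0 + k1 * s + k2 * (s * s) + k3 * (s * (s * s)).
have fE s : f s = k0 + k1 * s + k2 * s ^+ 2 + k3 * s ^+ 3 by rewrite /f; ring.
have fc : {within `[1 / 2, 2 : R], continuous f}.
  apply: continuous_subspaceT.
  rewrite /f; continuity.
have [|s0] := EVT_min _ fc; first lra.
rewrite in_itv /= => s0I smin.
have m0 : 0 <= f s0 by rewrite fE; exact: kp.
have := @cubic_zero_moment_ge0 _ (k0 - f s0) k1 k2 k3 s0 y0 y1 y2 y3 _ s0I _ P1 P2.
have -> // : k0 * y0 + k1 * y1 + k2 * y2 + k3 * y3 =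
   ((k0 - f s0) * y0 + k1 * y1 + k2 * y2 + k3 * y3) + f s0 * y0 by ring.
move=> h; rewrite addr_ge0 //.
  apply: h => [s sI|]; last by rewrite [f s0]fE; ring.
  have := smin s; rewrite in_itv /= sI => /(_ isT); rewrite [f s]fE; lra.
rewrite mulr_ge0 //; have := P1 1 0; have := P2 1 0; lra.
Qed.

Lemma psd_psd2 (a b c : R) : psd (mx_of_rows 2 2 [:: [:: a; b]; [:: b; c]]) <-> psd2 a b c.
Proof.
have E (v : 'cV[R]_2) : (v^T *m mx_of_rows 2 2 [:: [:: a; b]; [:: b; c]] *m v) 0 0 =
    a * v 0 0 ^+ 2 + 2 * b * (v 0 0 * v 1 0) + c * v 1 0 ^+ 2.
  by rewrite mxE sum2 !mxE !sum2 !mxE /=; ring.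
split => [[_ h] u v|h].
  by have := h (vec2 u v); rewrite E !mxE.
split; last by move=> v; rewrite E.
by apply: symmetricmxP => -[[|[|//]] ?] [[|[|//]] ?]; rewrite !mxE.
Qed.

(** For a quadratic vanishing at B, the quotient of its arc polynomial by [s - 1 / 2]; the
    coefficient [c] has been eliminated through the vanishing at B. *)
Definition cubB (p d e a b : R) (s : R) : R :=
  p * (s + 1 / 2) + 2 * d * (s ^+ 2 + 1 / 2 * s + 1 / 4) + 2 * e
  + a * (s ^+ 3 + 1 / 2 * s ^+ 2 + 1 / 4 * s + 1 / 8) + 2 * b * (s + 1 / 2).

Lemma cubBE (p d e a b c s : R) : qv p d e a b c (1 / 2) 2 = 0 -> s != 0 ->
  s ^+ 2 * qv p d e a b c s s^-1 = (s - 1 / 2) * cubB p d e a b s.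
Proof.
move=> qB s0; rewrite qv_arc //.
have -> : c = - (4 * e + b / 2 * 4 + p + d + a / 4) / 4 by move: qB; rewrite /qv; lra.
by rewrite /cubB; field.
Qed.

(** The right-hand side is the derivative of the quadratic at B along (1, -4), the tangent direction
    of the arc. *)
Lemma cubB_half (p d e a b c : R) : qv p d e a b c (1 / 2) 2 = 0 ->
  4 * cubB p d e a b (1 / 2) = (2 * d + a + 4 * b) - 4 * (2 * e + b + 4 * c).
Proof.
move=> qB.
have -> : c = - (4 * e + b / 2 * 4 + p + d + a / 4) / 4 by move: qB; rewrite /qv; lra.
by rewrite /cubB; field.
Qed.

Lemma cubB_ge0 (p d e a b c : R) : nonnegG p d e a b c -> qv p d e a b c (1 / 2) 2 = 0 ->
  forall s, 1 / 2 <= s <= 2 -> 0 <= cubB p d e a b s.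
Proof.
move=> q0 qB.
have H s : 1 / 2 <= s <= 2 -> 0 <= (s - 1 / 2) * cubB p d e a b s.
  move=> sI; rewrite -(cubBE qB); last by case/andP: sI => h _; rewrite gt_eqF //; lra.
  by rewrite mulr_ge0 ?sqr_ge0 // q0 //; exact: inG_arc.
move=> s sI; have [->|sN] := eqVneq s (1 / 2); last first.
  have := H s sI; rewrite pmulr_rge0 // subr_gt0 lt_def sN.
  by case/andP: sI.
(* At the endpoint the factor [s - 1 / 2] vanishes and cannot be cancelled, so the value is reached
   as a one-sided limit. *)
pose k t := (p + 2 * b + 3 * d + 3 / 2 * a) + (2 * d + 2 * a) * t + a * t ^+ 2.
have T t : cubB p d e a b (1 / 2 + t) = cubB p d e a b (1 / 2) + t * k t.
  by rewrite /cubB /k; field.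
apply: (@first_order_ge0 _ _ 1 (`|p + 2 * b + 3 * d + 3 / 2 * a| + `|2 * d + 2 * a| + `|a|) k).
- by [].
- move=> t /andP[t0 t1].
  have tn : `|t| <= 1 by rewrite gtr0_norm // ltW.
  rewrite /k !lerD //; first exact: ler_norm.
    by rewrite (le_trans (ler_norm _)) // normrM ler_piMr.
  by rewrite (le_trans (ler_norm _)) // normrM ler_piMr // normrX exprn_ile1.
- move=> t /andP[t0 t1]; have := H (1 / 2 + t).
  have -> : 1 / 2 <= 1 / 2 + t <= 2 by apply/andP; split; lra.
  by move/(_ isT); rewrite T; lra.
Qed.

(* Coordinates of the row u: (lambda_-, lambda_+) for D_1, then (y0, y1, y2)
   for D_2, (y0, y1, y2, y3) for D_3, and the multiple of z_B z_B^T. *)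
Definition ent (u : 'rV[R]_10) (k : nat) : R := u 0 (inord k).

Definition mkrow (s : seq R) : 'rV[R]_10 := \row_i nth 0 s i.

Lemma ent_mkrow s k : (k < 10)%N -> ent (mkrow s) k = nth 0 s k.
Proof. by move=> k10; rewrite /ent mxE inordK. Qed.

Definition feas (u : 'rV[R]_10) : Prop :=
  [/\ 0 <= ent u 0 /\ 0 <= ent u 1, psd2 (ent u 2) (ent u 3) (ent u 4),
      0 <= 5 / 2 * ent u 3 - ent u 4 - ent u 2,
      psd2 (ent u 6 - 1 / 2 * ent u 5) (ent u 7 - 1 / 2 * ent u 6) (ent u 8 - 1 / 2 * ent u 7)
    & psd2 (2 * ent u 5 - ent u 6) (2 * ent u 6 - ent u 7) (2 * ent u 7 - ent u 8)].

Definition comb (u : 'rV[R]_10) : 'M[R]_3 :=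
  sym3 (ent u 2 + (ent u 6 + 1 / 2 * ent u 5) + ent u 9)
       (ent u 3 + (ent u 7 + 1 / 2 * ent u 6 + 1 / 4 * ent u 5) + 1 / 2 * ent u 9)
       (- (ent u 0 + ent u 1) + 1 / 2 * ent u 2 + ent u 5 + 2 * ent u 9)
       (ent u 4 + (ent u 8 + 1 / 2 * ent u 7 + 1 / 4 * ent u 6 + 1 / 8 * ent u 5)
        + 1 / 4 * ent u 9)
       (- (1 / 2) * (ent u 0 + ent u 1) + 1 / 2 * ent u 3 + (ent u 6 + 1 / 2 * ent u 5) + ent u 9)
       (- (5 / 2 * ent u 0 + 4 * ent u 1) + 1 / 4 * ent u 2 + 4 * ent u 9).

Definition decomposable (Y : 'M[R]_3) : Prop :=
  exists (Y1 Y2 Y3 : 'M[R]_3) (l : R),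
    [/\ D_1 R Y1, D_2 R Y2, D_3 R Y3 & Y = Y1 + Y2 + Y3 + l *: (z_B R *m (z_B R)^T)].

Lemma decomposable_feas (Y : 'M[R]_3) :
  decomposable Y <-> exists2 u, feas u & Y = comb u.
Proof.
have z k : z_B R k 0 = nth 0 [:: 1; 1 / 2; 2] k.
  by rewrite mxE; case: k => [[|[|[|//]]] ?].
split => [[Y1 [Y2 [Y3 [l [[lm [lp [lm0 lp0 ->]]] [y0 [y1 [y2 [/psd_psd2 P1 h ->]]]]
     [z0 [z1 [z2 [z3 [/psd_psd2 P2 /psd_psd2 P3 ->]]]]] ->]]]]]|[u [[h1 h2] P1 h P2 P3 ->]]].
  exists (mkrow [:: lm; lp; y0; y1; y2; z0; z1; z2; z3; l]).
    by split; rewrite ?ent_mkrow.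
  by apply: mx3P; split; rewrite [LHS]mxE /comb !ent_mkrow //= !mxE big_ord1 !mxE /=; field.
exists (ent u 0 *: M_1 (1 / 2) + ent u 1 *: M_1 2).
eexists; eexists; exists (ent u 9); split.
- by exists (ent u 0), (ent u 1).
- by exists (ent u 2), (ent u 3), (ent u 4); split => //; apply/psd_psd2.
- by exists (ent u 5), (ent u 6), (ent u 7), (ent u 8); split => //; apply/psd_psd2.
- by apply: mx3P; split; rewrite !mxE big_ord1 !mxE /=; field.
Qed.

(** The coordinates pair with separate pieces of boundary data. When the quadratic vanishes at B,
    the first two coefficients are the values at 1/2 and 2 of its linear factor on AB; then come the
    coefficients of its restriction to AC, those of [cubB], and the value at B. *)
Lemma frob_comb u p d e a b c : frob (comb u) (sym3 p d e a b c) =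
  ent u 0 * (2 / 3 * (qv p d e a b c (1 / 2) (1 / 2) - qv p d e a b c (1 / 2) 2))
  + ent u 1 * (- (2 * e + b + 4 * c))
  + ((p + e + c / 4) * ent u 2 + (2 * d + b) * ent u 3 + a * ent u 4)
  + ((1 / 2 * p + 1 / 2 * d + 2 * e + 1 / 8 * a + b) * ent u 5
     + (p + d + 1 / 4 * a + 2 * b) * ent u 6 + (2 * d + 1 / 2 * a) * ent u 7 + a * ent u 8)
  + ent u 9 * qv p d e a b c (1 / 2) 2.
Proof. by rewrite frob_sym3 /comb !mxE /= /qv; field. Qed.

Lemma decomposable_dual (Y : 'M[R]_3) : decomposable Y -> dual_cone (N_B R) Y.
Proof.
move=> /decomposable_feas[u [[h1 h2] P1 h P2 P3] ->]; split; first exact: sym3_symmetric.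
move=> Q /N_B_sym3[p [d [e [a [b [c [-> q0 qB]]]]]]].
rewrite frob_comb qB mulr0 addr0 subr0.
have GA : inG (1 / 2 : R) (1 / 2) by split; try (apply/andP; split); lra.
(* Moving down AB from B by [t] changes the quadratic by
   [- (2 * e + b + 4 * c) * t + c * t ^+ 2]. *)
have lin2 : 0 <= - (2 * e + b + 4 * c).
  apply: (@first_order_ge0 _ _ 1 c (fun=> c)) => // t /andP[t0 t1].
  have : inG (1 / 2) (2 + - t) by split; try (apply/andP; split); lra.
  move/q0; rewrite -{1}(addr0 (1 / 2)) qvD qB; lra.
apply: addr_ge0; first apply: addr_ge0; first apply: addr_ge0.
- by rewrite mulr_ge0 // mulr_ge0 ?q0 // divr_ge0.
- exact: mulr_ge0.
- apply: quadratic_moment_ge0 => // s sI.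
  have : inG s (1 / 2).
    by split => //; try (apply/andP; split); case/andP: sI; lra.
  by move/q0; rewrite /qv; lra.
- apply: cubic_moment_ge0 => // s sI.
  by have := cubB_ge0 q0 qB sI; rewrite /cubB; lra.
Qed.

End Decomposition.

(** * The dual cone lies in the sum of the cones *)

Section Duality.
Context {R : realType}.
Implicit Types u v : 'rV[R]_10.

Lemma entD u v k : ent (u + v) k = ent u k + ent v k.
Proof. by rewrite /ent mxE. Qed.

Lemma entZ (t : R) u k : ent (t *: u) k = t * ent u k.
Proof. by rewrite /ent mxE. Qed.

Lemma ent0 k : ent (0 : 'rV[R]_10) k = 0.
Proof. by rewrite /ent mxE. Qed.

Lemma combD u v : comb (u + v) = comb u + comb v.
Proof. by apply: mx3P; split; rewrite !mxE /= !entD; ring. Qed.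

Lemma combZ (t : R) u : comb (t *: u) = t *: comb u.
Proof. by apply: mx3P; split; rewrite !mxE /= !entZ; ring. Qed.

Lemma feasD u v : feas u -> feas v -> feas (u + v).
Proof.
move=> [[a1 a2] a3 a4 a5 a6] [[b1 b2] b3 b4 b5 b6]; split; rewrite !entD.
- by split; apply: addr_ge0.
- move=> x y; have := a3 x y; have := b3 x y; lra.
- lra.
- move=> x y; have := a5 x y; have := b5 x y; lra.
- move=> x y; have := a6 x y; have := b6 x y; lra.
Qed.

Lemma psd2Z (t a b c a' b' c' : R) : 0 <= t -> psd2 a b c ->
  a' = t * a -> b' = t * b -> c' = t * c -> psd2 a' b' c'.
Proof.
move=> t0 h -> -> -> x y; have := mulr_ge0 t0 (h x y); lra.
Qed.

Lemma feasZ (t : R) u : 0 <= t -> feas u -> feas (t *: u).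
Proof.
move=> t0 [[a1 a2] a3 a4 a5 a6]; split; rewrite !entZ.
- by split; apply: mulr_ge0.
- exact: (psd2Z t0 a3).
- have := mulr_ge0 t0 a4; lra.
- by apply: (psd2Z t0 a5); ring.
- by apply: (psd2Z t0 a6); ring.
Qed.

Lemma feas0 : feas (0 : 'rV[R]_10).
Proof. by split; rewrite ?ent0; try split; try (move=> x y); lra. Qed.

Lemma ent_continuous k : continuous (fun u : 'rV[R]_10 => ent u k).
Proof. exact: coord_continuous. Qed.

Lemma psd2_closed (f g h : 'rV[R]_10 -> R) : continuous f -> continuous g -> continuous h ->
  closed [set u | psd2 (f u) (g u) (h u)].
Proof.
move=> cf cg ch; apply: closed_forall => x; apply: closed_forall => y.
by apply: closed_ge0; continuity.
Qed.

Lemma feas_closed : closed [set u : 'rV[R]_10 | feas u].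
Proof.
rewrite (_ : mkset _ = [set u | 0 <= ent u 0] `&` [set u | 0 <= ent u 1]
  `&` [set u | psd2 (ent u 2) (ent u 3) (ent u 4)]
  `&` [set u | 0 <= 5 / 2 * ent u 3 - ent u 4 - ent u 2]
  `&` [set u | psd2 (ent u 6 - 1 / 2 * ent u 5) (ent u 7 - 1 / 2 * ent u 6)
                    (ent u 8 - 1 / 2 * ent u 7)]
  `&` [set u | psd2 (2 * ent u 5 - ent u 6) (2 * ent u 6 - ent u 7)
                    (2 * ent u 7 - ent u 8)]).
  by repeat apply: closedI; first [apply: closed_ge0 | apply: psd2_closed]; continuity.
by apply/seteqP; split => [u [[]]|u [[[[[]]]]]].
Qed.

(* The pairing of comb u with the quadratic (x - 1/2) + (2 - y), which vanishes
   only at B on G, is a positive combination of the coordinates of u. *)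
Lemma feas_bounded (u : 'rV[R]_10) (E : R) : feas u ->
  (forall i j, `|comb u i j| <= E) -> forall i, `|u 0 i| <= 100 * E.
Proof.
move=> [[a1 a2] P1 h P2 P3] hE i.
have : `|u 0 i| \in [seq `|ent u k| | k <- iota 0 10].
  apply/mapP; exists (i : nat); last by rewrite /ent inord_val.
  by rewrite mem_iota ltn_ord.
have := hE 0 0; have := hE 0 1; have := hE 0 ord_max.
have := P1 1 0; have := P1 0 1; have := P2 1 0; have := P2 0 1; have := P3 1 0; have := P3 0 1.
rewrite !mxE /= !ler_norml; move: a1 a2 h {P1 P2 P3 hE}.
move: (ent u 0) (ent u 1) (ent u 2) (ent u 3) (ent u 4) (ent u 5) (ent u 6) (ent u 7)
  (ent u 8) (ent u 9) => x0 x1 x2 x3 x4 x5 x6 x7 x8 x9.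
move=> a1 a2 h g1 g2 g3 g4 g5 g6 /andP[h1 h2] /andP[h3 h4] /andP[h5 h6].
rewrite !inE -ler_norml; move: (u 0 i) => z.
by do 9?[case/orP]; move=> /eqP->; rewrite ler_norml; apply/andP; split; lra.
Qed.

Lemma entry_le_frob n (N : 'M[R]_n) i j : N \is symmetricmx -> N i j ^+ 2 <= frob N N.
Proof.
move=> Ns; rewrite frob_sqr // (bigD1 i) //= (bigD1 j) //= -addrA lerDl.
apply: addr_ge0; apply: sumr_ge0 => k _; first exact: sqr_ge0.
by apply: sumr_ge0 => l _; exact: sqr_ge0.
Qed.

Lemma symmetricmxB n (U V : 'M[R]_n) : U \is symmetricmx -> V \is symmetricmx ->
  U - V \is symmetricmx.
Proof.
move=> /symmetricmxE hU /symmetricmxE hV.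
by apply: symmetricmxP => i j; rewrite !mxE hU hV.
Qed.

Lemma comb_symmetric u : comb u \is symmetricmx.
Proof. exact: sym3_symmetric. Qed.

Lemma sym3_continuous (T : topologicalType) (p d e a b c : T -> R) :
  continuous p -> continuous d -> continuous e -> continuous a -> continuous b ->
  continuous c -> forall i j,
  continuous (fun t => sym3 (p t) (d t) (e t) (a t) (b t) (c t) i j).
Proof.
move=> cp cd ce ca cb cc i j.
have E (f g : T -> R) : (forall t, f t = g t) -> continuous g -> continuous f.
  by move=> /funext ->.
case: i j => [[|[|[|//]]] ?] [[|[|[|//]]] ?];
  by [apply: (E _ p) => // t; rewrite mxE | apply: (E _ d) => // t; rewrite mxE
     |apply: (E _ e) => // t; rewrite mxE | apply: (E _ a) => // t; rewrite mxE
     |apply: (E _ b) => // t; rewrite mxE | apply: (E _ c) => // t; rewrite mxE].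
Qed.

(** Only rows whose distance to [Y] is at most that of the zero row matter; they form a closed set,
    bounded by [feas_bounded]. *)
Lemma comb_nearest (Y : 'M[R]_3) : Y \is symmetricmx ->
  exists2 u, feas u & forall v, feas v ->
    frob (comb u - Y) (comb u - Y) <= frob (comb v - Y) (comb v - Y).
Proof.
move=> Ys.
have Ds u : comb u - Y \is symmetricmx by exact: symmetricmxB (comb_symmetric u) Ys.
pose h u := frob (comb u - Y) (comb u - Y).
have hc : continuous h.
  have c i j : continuous (fun u => (comb u - Y) i j).
    rewrite (_ : (fun _ => _) = fun u => comb u i j + - Y i j); last first.
      by apply/funext => u; rewrite !mxE.
    apply: continuous_add; last exact: cst_continuous.
    by apply: sym3_continuous; continuity; exact: ent_continuous.
  exact: continuous_frob.
pose F := frob Y Y.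
have h0 : h 0 = F.
  have -> : (0 : 'rV[R]_10) = 0 *: 0 by rewrite scale0r.
  rewrite /h combZ scale0r sub0r /F frobNl frobC frobNl; ring.
have F0 : 0 <= F by rewrite /F frob_sqr //; do 2!apply: sumr_ge0 => ? _; exact: sqr_ge0.
(* An entry of [comb u - Y] has square at most [F], hence absolute value at most [F + 1]; the double
   sum bounds the entries of [Y]. *)
pose E := F + 1 + \sum_i \sum_j `|Y i j|.
have YE i j : `|Y i j| <= \sum_i \sum_j `|Y i j|.
  rewrite (bigD1 i) //= (bigD1 j) //= -addrA lerDl.
  by apply: addr_ge0; apply: sumr_ge0 => // k _; apply: sumr_ge0.
have [||||u [Fu hu] umin] := @rV_min _ _ [set u | feas u /\ 0 <= F - h u] (100 * E) h.
- rewrite (_ : mkset _ = [set u | feas u] `&` [set u | 0 <= F - h u]) //.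
  apply: closedI; first exact: feas_closed.
  by apply: closed_ge0; continuity.
- move=> u [fu]; rewrite subr_ge0 => hu; apply: feas_bounded => // i j.
  have := le_trans (entry_le_frob i j (Ds u)) hu.
  rewrite [(comb u - Y) i j]mxE [(- Y) i j]mxE => e1.
  rewrite -(subrK (Y i j) (comb u i j)) (le_trans (ler_normD _ _)) // lerD //.
  rewrite -real_normK ?num_real // in e1.
  have := normr_ge0 (comb u i j - Y i j); nra.
- by exists 0; split; [exact: feas0|rewrite h0 subrr].
- exact: hc.
- exists u => // v fv; have [vF|Fv] := leP (h v) F; first by apply: umin; split; rewrite ?subr_ge0.
  by rewrite ltW // (le_lt_trans _ Fv) // -subr_ge0.
Qed.

(** The residual [N] at the nearest point is nonnegative on the cone and orthogonal to [comb u].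
    Testing it on generators shows that it belongs to [N_B], so its pairing with [Y] is nonnegative;
    but this pairing is [- frob N N], whence [N = 0]. *)
Lemma dual_decomposable (Y : 'M[R]_3) : dual_cone (N_B R) Y -> decomposable Y.
Proof.
move=> [Ys Yd]; have [u fu umin] := comb_nearest Ys.
apply/decomposable_feas; exists u => //.
set N := comb u - Y in umin.
have Ns : N \is symmetricmx by exact: symmetricmxB (comb_symmetric u) Ys.
have ob v : feas v -> 0 <= frob (comb v - comb u) N.
  move=> fv; apply: (@nearest_point_obtuse _ _ (comb @` feas)).
    move=> t /andP[t0 t1]; exists ((1 - t) *: u + t *: v).
      by apply: feasD; apply: feasZ => //; lra.
    rewrite combD !combZ; apply/matrixP => i j; rewrite !mxE; ring.
  by move=> _ [w fw <-]; exact: umin.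
(* Compare with the rows 0 and [u + u], on either side of [u] on its ray. *)
have uN : frob (comb u) N = 0.
  have := ob _ feas0; have := ob _ (feasD fu fu).
  rewrite !frobBl combD frobDl -(scale0r (0 : 'rV[R]_10)) combZ frobZl; lra.
have pos v : feas v -> 0 <= frob (comb v) N by move=> fv; have := ob v fv; rewrite frobBl uN subr0.
have [/eqP|N0] := eqVneq N 0; first by rewrite /N subr_eq0 => /eqP.
have YN : frob Y N = - frob N N.
  by rewrite -[X in - X](_ : frob (comb u - Y) N = _) // frobBl uN; ring.
suff : 0 <= frob Y N by rewrite YN oppr_ge0 leNgt (frob_sqr_gt0 Ns N0).
apply: Yd.
move: pos; rewrite (symmetric_sym3 Ns).
move: (N 0 0) (N 0 1) (N 0 ord_max) (N 1 1) (N 1 ord_max) (N ord_max ord_max) => p d e a b c pos.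
have test s : feas (mkrow s) -> 0 <= frob (comb (mkrow s)) (sym3 p d e a b c) by exact: pos.
have qB : qv p d e a b c (1 / 2) 2 = 0.
  (* The multiple of the rank-one matrix at B may have either sign, so its pairing must vanish. *)
  have t l : 0 <= l * qv p d e a b c (1 / 2) 2.
    have := test [:: 0; 0; 0; 0; 0; 0; 0; 0; 0; l].
    rewrite frob_comb !ent_mkrow //= !mulr0 !mul0r !add0r; apply.
    by split; rewrite !ent_mkrow //=; try split; try (move=> x y); lra.
  have := t 1; have := t (-1); lra.
apply/N_B_sym3; exists p, d, e, a, b, c; split => //.
have lin2 : 2 * e + b + 4 * c <= 0.
  have := test [:: 0; 1; 0; 0; 0; 0; 0; 0; 0; 0].
  rewrite frob_comb !ent_mkrow //= !mulr0 !mul0r !add0r !addr0 mul1r oppr_ge0; apply.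
  by split; rewrite !ent_mkrow //=; try split; try (move=> x y); lra.
have hAC s : 1 / 2 <= s <= 2 -> 0 <= qv p d e a b c s (1 / 2).
  (* Moments of the unit mass at [s], which recover the value at the point of AC with abscissa
     [s]. *)
  move=> /andP[s1 s2]; have := test [:: 0; 0; 1; s; s ^+ 2; 0; 0; 0; 0; 0].
  rewrite frob_comb !ent_mkrow //= !mulr0 !mul0r !add0r !addr0 => h.
  rewrite [X in 0 <= X](_ : _ = (p + e + c / 4) * 1 + (2 * d + b) * s + a * s ^+ 2);
    last by rewrite /qv; field.
  apply: h; split; rewrite !ent_mkrow //=; try split; try (move=> x y); try lra.
  - have := sqr_ge0 (x + s * y); lra.
  - have : 0 <= (s - 1 / 2) * (2 - s) by apply: mulr_ge0; lra.
    lra.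
have cub s : 1 / 2 <= s <= 2 -> 0 <= cubB p d e a b s.
  (* Moments up to order three of the unit mass at [s], which recover the value of [cubB] there. *)
  move=> /andP[s1 s2]; have := test [:: 0; 0; 0; 0; 0; 1; s; s ^+ 2; s ^+ 3; 0].
  rewrite frob_comb !ent_mkrow //= !mulr0 !mul0r !add0r !addr0 => h.
  rewrite [X in 0 <= X](_ : _ = (1 / 2 * p + 1 / 2 * d + 2 * e + 1 / 8 * a + b) * 1
     + (p + d + 1 / 4 * a + 2 * b) * s + (2 * d + 1 / 2 * a) * s ^+ 2 + a * s ^+ 3);
    last by rewrite /cubB; field.
  apply: h; split; rewrite !ent_mkrow //=; try split; try (move=> x y); try lra.
  - have : 0 <= (s - 1 / 2) * (x + s * y) ^+ 2 by rewrite mulr_ge0 ?sqr_ge0 // subr_ge0.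
    lra.
  - have : 0 <= (2 - s) * (x + s * y) ^+ 2 by rewrite mulr_ge0 ?sqr_ge0 // subr_ge0.
    lra.
apply: boundary_ge0 => //.
- have h2 : 1 / 2 <= (1 / 2 : R) <= 2 by apply/andP; split; lra.
  have := cub _ h2; have := cubB_half qB; lra.
- move=> s sI; have s0 : 0 < s by case/andP: sI; lra.
  have : 0 <= s ^+ 2 * qv p d e a b c s s^-1.
    rewrite (cubBE qB) ?gt_eqF // mulr_ge0 ?cub // subr_ge0; by case/andP: sI.
  by rewrite pmulr_rge0 // exprn_gt0.
Qed.

End Duality.

(** * Separating a matrix from the hull by a quadratic *)

Section Separation.
Context {R : realType}.

Lemma frob_delta n (M : 'M[R]_n) i j : frob M (delta_mx i j) = M j i.
Proof.
rewrite /frob /mxtrace (bigD1 j) //= mxE (bigD1 i) //= mxE !eqxx mulr1.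
rewrite big1 => [|k ki]; last by rewrite mxE (negbTE ki) mulr0.
rewrite big1 ?addr0 // => k kj; rewrite mxE big1 // => l _.
by rewrite mxE (negbTE kj) andbF mulr0.
Qed.

Lemma frob_rank1 n (M : 'M[R]_n) (v : 'cV[R]_n) :
  frob M (v *m v^T) = (v^T *m M *m v) 0 0.
Proof. by rewrite /frob mulmxA mxtrace_mulC mulmxA trace_mx11. Qed.

Lemma frob_lift1_rank1 (x : 'cV[R]_2) (v : 'cV[R]_3) :
  0 <= frob (lift1 x *m (lift1 x)^T) (v *m v^T).
Proof.
rewrite frobC frob_rank1 -mulmxA -mulmxA mulmxA mxE big_ord1.
have -> : (v^T *m lift1 x) 0 0 = ((lift1 x)^T *m v) 0 0.
  by transitivity (((lift1 x)^T *m v)^T 0 0); [rewrite trmx_mul trmxK|rewrite mxE].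
by rewrite -expr2 sqr_ge0.
Qed.

(** Two opposite half-spaces. Linear equations such as symmetry and the unit corner pass from the
    generators to the hull in this way. *)
Lemma Cbar_eq D (Q : 'M[R]_3) (k : R) :
  (forall x, D x -> frob (lift1 x *m (lift1 x)^T) Q = k) ->
  forall M, Cbar D M -> frob M Q = k.
Proof.
move=> DQ M CM; apply/le_anti/andP; split; last first.
  by apply: (Cbar_halfspace _ CM) => x /DQ ->.
rewrite -lerN2 -[- frob M Q]mulN1r -frobZr; apply: (Cbar_halfspace _ CM) => x /DQ h.
by rewrite frobZr h mulN1r.
Qed.

Lemma Cbar_symmetric D (M : 'M[R]_3) : Cbar D M -> M \is symmetricmx.
Proof.
move=> CM; apply: symmetricmxP => i j; apply/eqP; rewrite -subr_eq0; apply/eqP.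
rewrite -!frob_delta -frobBr; apply: (Cbar_eq _ CM) => x _.
by rewrite frobBr !frob_delta lift1_sym3 (symmetricmxE (sym3_symmetric _ _ _ _ _ _)) subrr.
Qed.

Lemma Cbar_corner D (M : 'M[R]_3) : Cbar D M -> M 0 0 = 1.
Proof.
move=> CM; rewrite -(frob_delta M); apply: (Cbar_eq _ CM) => x _.
by rewrite frob_delta lift1_sym3 mxE.
Qed.

Lemma Cbar_psd D (M : 'M[R]_3) : Cbar D M -> psd M.
Proof.
move=> CM; split; first exact: Cbar_symmetric CM.
by move=> v; rewrite -frob_rank1; apply: (Cbar_halfspace _ CM) => x _; exact: frob_lift1_rank1.
Qed.

Lemma Cbar_nonnegG (M : 'M[R]_3) (k p d e a b c : R) : Cbar (G R) M ->
  (forall x y, inG x y -> k <= qv p d e a b c x y) -> k <= frob M (sym3 p d e a b c).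
Proof.
move=> CM q0; apply: (Cbar_halfspace _ CM) => x /G_inG Gx; rewrite frob_lift1; exact: q0.
Qed.

Lemma frob_sym3_swap (t x y xx xy yy p d e a b c : R) :
  frob (sym3 t y x yy xy xx) (sym3 p d e a b c) = frob (sym3 t x y xx xy yy) (sym3 p e d c b a).
Proof. by rewrite !frob_sym3 !mxE /=; ring. Qed.

Definition sym6 (u : 'rV[R]_6) : 'M[R]_3 :=
  sym3 (u 0 (inord 0)) (u 0 (inord 1)) (u 0 (inord 2)) (u 0 (inord 3)) (u 0 (inord 4))
    (u 0 (inord 5)).

Definition row6 (s : seq R) : 'rV[R]_6 := \row_i nth 0 s i.

Lemma sym6_row6 p d e a b c : sym6 (row6 [:: p; d; e; a; b; c]) = sym3 p d e a b c.
Proof. by rewrite /sym6 !mxE !inordK. Qed.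

Lemma mem_row6 (u : 'rV[R]_6) i : u 0 i \in [seq u 0 (inord k) | k <- iota 0 6].
Proof.
by apply/mapP; exists (i : nat); rewrite ?inord_val // mem_iota ltn_ord.
Qed.

(** The normal at the nearest point of the hull separates. Since [Y] and all hull elements have
    corner entry 1, the constant of the separating hyperplane can be absorbed into the constant term
    of a quadratic. *)
Lemma Cbar_separation (Y : 'M[R]_3) : Y \is symmetricmx -> Y 0 0 = 1 -> ~ Cbar (G R) Y ->
  exists p d e a b c, nonnegG p d e a b c /\ frob Y (sym3 p d e a b c) < 0.
Proof.
move=> Ys Y1 nC.
have c6 i j : continuous (fun u => sym6 u i j).
  by apply: sym3_continuous; exact: coord_continuous.
have cl : closed [set u | Cbar (G R) (sym6 u)].
  have /continuous_closedP := continuous_mx c6; apply; exact: Cbar_closed.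
have GA : G R (vec2 (1 / 2) (1 / 2)).
  by apply: (inG_vec2 _ _).1; split; try (apply/andP; split); lra.
have [|||u Cu umin] := @rV_min _ _ _ 4 (fun u => frob (sym6 u - Y) (sym6 u - Y)) cl.
- move=> u Cu i; rewrite ler_norml.
  have H k p d e a b c := @Cbar_nonnegG (sym6 u) k p d e a b c Cu.
  move: H (mem_row6 u i); rewrite /sym6 !inE.
  move: (u 0 (inord 0)) (u 0 (inord 1)) (u 0 (inord 2)) (u 0 (inord 3)) (u 0 (inord 4))
    (u 0 (inord 5)) => x0 x1 x2 x3 x4 x5 H.
  (* Each coordinate of the row, doubled when off-diagonal, pairs with a monomial whose values on G
     lie in [0, 4]; the hull inherits these bounds. *)
  have T p d e a b c : (forall x y, inG x y -> 0 <= qv p d e a b c x y <= 4) ->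
     0 <= x0 * p + 2 * (x1 * d + x2 * e + x4 * b) + x3 * a + x5 * c /\
     x0 * p + 2 * (x1 * d + x2 * e + x4 * b) + x3 * a + x5 * c <= 4.
    move=> h; split.
      have := H 0 p d e a b c; rewrite frob_sym3 !mxE /=.
      by move=> /(_ (fun x y g => (andP (h x y g)).1)); lra.
    have := H (- 4) (- p) (- d) (- e) (- a) (- b) (- c); rewrite frob_sym3 !mxE /= => {}H.
    suff: forall x y, inG x y -> - 4 <= qv (- p) (- d) (- e) (- a) (- b) (- c) x y
      by move=> /H; lra.
    by move=> x y /h /andP[_]; rewrite /qv => {}h; lra.
  have B (x y : R) : inG x y -> [/\ 0 <= 2 * x <= 4, 0 <= 2 * y <= 4, 0 <= x ^+ 2 <= 4,
      0 <= y ^+ 2 <= 4 & 0 <= 2 * (x * y) <= 4].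
    move=> [/andP[? ?] /andP[? ?] ?].
    have sq (z : R) : 1 / 2 <= z -> z <= 2 -> 0 <= z ^+ 2 <= 4.
      move=> z1 z2; rewrite sqr_ge0 /=.
      have : 0 <= (2 - z) * (2 + z) by rewrite mulr_ge0; lra.
      lra.
    have xy0 : 0 <= x * y by rewrite mulr_ge0; lra.
    by split; rewrite ?sq //; apply/andP; split; lra.
  have [|? ?] := T 1 0 0 0 0 0; first by move=> x y _; rewrite /qv; apply/andP; split; lra.
  have [|? ?] := T 0 1 0 0 0 0.
    by move=> x y /B[/andP[? ?] _ _ _ _]; rewrite /qv; apply/andP; split; lra.
  have [|? ?] := T 0 0 1 0 0 0.
    by move=> x y /B[_ /andP[? ?] _ _ _]; rewrite /qv; apply/andP; split; lra.
  have [|? ?] := T 0 0 0 1 0 0.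
    by move=> x y /B[_ _ /andP[? ?] _ _]; rewrite /qv; apply/andP; split; lra.
  have [|? ?] := T 0 0 0 0 1 0.
    by move=> x y /B[_ _ _ _ /andP[? ?]]; rewrite /qv; apply/andP; split; lra.
  have [|? ?] := T 0 0 0 0 0 1.
    by move=> x y /B[_ _ _ /andP[? ?] _]; rewrite /qv; apply/andP; split; lra.
  by do 5?[case/orP]; move=> /eqP->; apply/andP; split; lra.
- exists (row6 [:: 1; 1 / 2; 1 / 2; (1 / 2) ^+ 2; 1 / 2 * (1 / 2); (1 / 2) ^+ 2]).
  by rewrite /= sym6_row6; have := Cbar_lift GA; rewrite lift1_sym3 !mxE.
- have c i j : continuous (fun u => (sym6 u - Y) i j).
    rewrite (_ : (fun _ => _) = fun u => sym6 u i j + - Y i j); last first.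
      by apply/funext => u; rewrite mxE [(- Y) i j]mxE.
    by apply: continuous_add; [exact: c6|exact: cst_continuous].
  exact: continuous_frob.
set P := sym6 u in Cu umin; set N := P - Y in umin.
have Ns : N \is symmetricmx by apply: symmetricmxB => //; exact: sym3_symmetric.
have PY : forall M, Cbar (G R) M -> 0 <= frob (M - P) N.
  move=> M CM; apply: (@nearest_point_obtuse _ _ (Cbar (G R))).
    move=> t /andP[t0 t1].
    have -> : P + t *: (M - P) = t *: M + (1 - t) *: P.
      by rewrite scalerBr scalerBl scale1r addrCA.
    by apply: Cbar_convex => //; rewrite !ltW.
  move=> M'; set q := frob _ _ => CM'.
  have := umin (row6 [:: M' 0 0; M' 0 1; M' 0 ord_max; M' 1 1; M' 1 ord_max; M' ord_max ord_max]).
  by rewrite /= sym6_row6 -(symmetric_sym3 (Cbar_symmetric CM')); apply.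
have N0 : N != 0 by apply/eqP => /eqP; rewrite subr_eq0 => /eqP E; apply: nC; rewrite -E.
have NN := frob_sqr_gt0 Ns N0.
pose k := frob P N.
exists (N 0 0 - k), (N 0 1), (N 0 ord_max), (N 1 1), (N 1 ord_max), (N ord_max ord_max).
have E (M : 'M[R]_3) : M 0 0 = 1 ->
    frob M (sym3 (N 0 0 - k) (N 0 1) (N 0 ord_max) (N 1 1) (N 1 ord_max) (N ord_max ord_max))
    = frob M N - k.
  by move=> M1; rewrite [in RHS](symmetric_sym3 Ns) !frob_sym3 M1; ring.
split.
  move=> x y /(inG_vec2 _ _).1 Gxy; have CL := Cbar_lift Gxy.
  have := frob_lift1 (vec2 x y) (N 0 0 - k) (N 0 1) (N 0 ord_max) (N 1 1) (N 1 ord_max)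
    (N ord_max ord_max).
  rewrite [vec2 x y 0 0]mxE [vec2 x y 1 0]mxE => <-; rewrite E; last exact: Cbar_corner CL.
  by have := PY _ CL; rewrite frobBl.
rewrite E // (_ : frob Y N - k = - frob N N) ?oppr_lt0 //.
by rewrite {2}/N frobBl /k; ring.
Qed.

End Separation.

(** * Extremal separators, and hull membership from the two dual conditions *)

Section ExtremalSeparator.
Context {R : realType}.

(** On the compact part of G where the square is at least [ep], the quadratic has no zero, hence a
    positive minimum. The factor is the bound [L] of the square on G divided by this minimum, or 0
    if that part is empty. *)
Lemma linear_form_domination (p d e a b c l m n ep : R) :
  nonnegG p d e a b c ->
  (forall x y, inG x y -> qv p d e a b c x y = 0 -> l * x + m * y + n = 0) ->
  0 < ep -> exists k, 0 <= k /\ forall x y, inG x y ->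
    (l * x + m * y + n) ^+ 2 <= ep + k * qv p d e a b c x y.
Proof.
move=> q0 z ep0.
pose X (u : 'rV[R]_2) := u 0 0; pose Z (u : 'rV[R]_2) := u 0 1.
have Xc : continuous X by exact: coord_continuous.
have Zc : continuous Z by exact: coord_continuous.
pose q u := p + 2 * d * X u + 2 * e * Z u + a * (X u * X u) + 2 * b * (X u * Z u)
  + c * (Z u * Z u).
have qE u : q u = qv p d e a b c (X u) (Z u) by rewrite /q /qv; ring.
pose f u := (l * X u + m * Z u + n) * (l * X u + m * Z u + n).
pose D := [set u | inG (X u) (Z u) /\ ep <= f u].
have Dc : closed D.
  rewrite (_ : D = [set u | 0 <= X u - 1 / 2] `&` [set u | 0 <= 2 - X u]
    `&` [set u | 0 <= Z u - 1 / 2] `&` [set u | 0 <= 2 - Z u]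
    `&` [set u | 0 <= 1 - X u * Z u] `&` [set u | 0 <= f u - ep]).
    by repeat apply: closedI; apply: closed_ge0; rewrite /f; continuity.
  apply/seteqP; split => u /=; rewrite !subr_ge0.
    by case=> [[/andP[? ?] /andP[? ?] ?] ?].
  by case=> [[[[[h1 h2] h3] h4] h5] h6]; split => //; split; rewrite ?h1 ?h3.
pose L := (2 * `|l| + 2 * `|m| + `|n|) ^+ 2.
have fL x y : inG x y -> (l * x + m * y + n) ^+ 2 <= L.
  move=> [/andP[x1 x2] /andP[y1 y2] _].
  rewrite -real_normK ?num_real // ler_sqr ?nnegrE ?addr_ge0 ?mulr_ge0 //.
  rewrite (le_trans (ler_normD _ _)) // lerD // (le_trans (ler_normD _ _)) // !normrM.
  rewrite [`|x|]ger0_norm ?[`|y|]ger0_norm; try lra.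
  by rewrite lerD // mulrC ler_wpM2r.
have L0 : 0 <= L by exact: sqr_ge0.
have qc : continuous q by rewrite /q; continuity.
pose vec x y : 'rV[R]_2 := \row_i nth 0 [:: x; y] i.
have vX x y : X (vec x y) = x by rewrite /X mxE.
have vZ x y : Z (vec x y) = y by rewrite /Z mxE.
have [[u0 Du0]|nD] := pselect (D !=set0); last first.
  exists 0; split => // x y Gxy; rewrite mul0r addr0 leNgt; apply/negP => h.
  by apply: nD; exists (vec x y); split; rewrite /f ?vX ?vZ // -expr2 ltW.
have [||u [Gu fu] umin] := @rV_min _ _ D 2 q Dc _ _ qc.
- move=> u [[/andP[? ?] /andP[? ?] _] _] i; rewrite ler_norml.
  case: i => [[|[|//]] h].
    have -> : u 0 (Ordinal h) = X u by congr (u _ _); exact: val_inj.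
    by apply/andP; split; lra.
  have -> : u 0 (Ordinal h) = Z u by congr (u _ _); exact: val_inj.
  by apply/andP; split; lra.
- by exists u0.
have qu : 0 < q u.
  rewrite qE lt_def q0 // andbT; apply/eqP => /(z _ _ Gu) h.
  by move: fu; rewrite /f h mul0r leNgt ep0.
exists (L / q u); split; first by rewrite divr_ge0 // ltW.
move=> x y Gxy; have q1 := q0 _ _ Gxy.
have [h|h] := leP ep ((l * x + m * y + n) ^+ 2); last first.
  by rewrite ltW // (lt_le_trans h) // lerDl mulr_ge0 // divr_ge0 // ltW.
have : q u <= q (vec x y) by apply: umin; split; rewrite /f ?vX ?vZ // -expr2.
rewrite [q (vec x y)]qE vX vZ => h2; rewrite (le_trans (fL _ _ Gxy)) //.
apply: (@le_trans _ _ (L / q u * qv p d e a b c x y)); last by rewrite lerDr ltW.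
by rewrite mulrAC ler_pdivlMr // ler_wpM2l.
Qed.

(* Sum of the values at six points of G that determine a quadratic. *)
Definition sum6 (p d e a b c : R) : R :=
  let q := qv p d e a b c in
  q (1 / 2) (1 / 2) + q (3 / 4) (1 / 2) + q 1 (1 / 2) + q (1 / 2) (3 / 4) + q (1 / 2) 1
  + q (3 / 4) (3 / 4).

Lemma nonnegG_six (p d e a b c : R) : nonnegG p d e a b c ->
  let q := qv p d e a b c in
  [/\ 0 <= q (1 / 2) (1 / 2), 0 <= q (3 / 4) (1 / 2) & 0 <= q 1 (1 / 2)] /\
  [/\ 0 <= q (1 / 2) (3 / 4), 0 <= q (1 / 2) 1 & 0 <= q (3 / 4) (3 / 4)].
Proof.
by move=> q0; do !split; apply: q0; split; try (apply/andP; split); lra.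
Qed.

Lemma sum6_ge0 (p d e a b c : R) : nonnegG p d e a b c -> 0 <= sum6 p d e a b c.
Proof.
move=> /nonnegG_six[[h1 h2 h3] [h4 h5 h6]].
exact: addr_ge0 (addr_ge0 (addr_ge0 (addr_ge0 (addr_ge0 h1 h2) h3) h4) h5) h6.
Qed.

(** Each of the six values lies between 0 and [s], and interpolation at the six points expresses
    every coefficient through them; 1000 is a crude bound for the weights. *)
Lemma coef_bound (p d e a b c s : R) : nonnegG p d e a b c -> sum6 p d e a b c = s ->
  [/\ `|p| <= 1000 * s, `|d| <= 1000 * s & `|e| <= 1000 * s] /\
  [/\ `|a| <= 1000 * s, `|b| <= 1000 * s & `|c| <= 1000 * s].
Proof.
move=> /nonnegG_six[[h1 h2 h3] [h4 h5 h6]]; rewrite /sum6.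
move: h1 h2 h3 h4 h5 h6; rewrite /qv => h1 h2 h3 h4 h5 h6 E.
by do !split; rewrite ler_norml; apply/andP; split; lra.
Qed.

Lemma sum6_gt0 (p d e a b c : R) (Y : 'M[R]_3) : nonnegG p d e a b c ->
  frob Y (sym3 p d e a b c) != 0 -> 0 < sum6 p d e a b c.
Proof.
move=> q0 Yq.
rewrite lt_def sum6_ge0 // andbT.
apply: contraNneq Yq => s0; have [[p0 d0 e0] [a0 b0 c0]] := coef_bound q0 s0.
move: p0 d0 e0 a0 b0 c0; rewrite mulr0 !normr_le0 => /eqP-> /eqP-> /eqP-> /eqP-> /eqP-> /eqP->.
by rewrite frob_sym3 !mulr0 !addr0.
Qed.

(** The slice [sum6 = 1] of the cone of nonnegative quadratics is compact, so the pairing with [Y]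
    attains its minimum there. Homogeneity extends the lower bound to the whole cone. *)
Lemma extremal_separator (Y : 'M[R]_3) :
  (exists p d e a b c, nonnegG p d e a b c /\ frob Y (sym3 p d e a b c) < 0) ->
  exists p d e a b c, let m := frob Y (sym3 p d e a b c) in
    [/\ nonnegG p d e a b c, m < 0, sum6 p d e a b c = 1 &
     forall p' d' e' a' b' c', nonnegG p' d' e' a' b' c' ->
       m * sum6 p' d' e' a' b' c' <= frob Y (sym3 p' d' e' a' b' c')].
Proof.
move=> [p0 [d0 [e0 [a0 [b0 [c0 [q0 Yq0]]]]]]].
pose C k (u : 'rV[R]_6) := u 0 (inord k).
have Cc k : continuous (C k) by exact: coord_continuous.
pose qu x y u := C 0 u + 2 * C 1 u * x + 2 * C 2 u * y + C 3 u * x ^+ 2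
  + 2 * C 4 u * (x * y) + C 5 u * y ^+ 2.
have quc x y : continuous (qu x y) by rewrite /qu; continuity.
pose Q T (F : R -> R -> R -> R -> R -> R -> T) u :=
  F (C 0 u) (C 1 u) (C 2 u) (C 3 u) (C 4 u) (C 5 u).
have quE x y u : qu x y u = Q _ (fun p d e a b c => qv p d e a b c x y) u
  by rewrite /qu /Q /qv; ring.
pose s6 u := qu (1 / 2) (1 / 2) u + qu (3 / 4) (1 / 2) u + qu 1 (1 / 2) u + qu (1 / 2) (3 / 4) u
  + qu (1 / 2) 1 u + qu (3 / 4) (3 / 4) u.
have s6E u : s6 u = Q _ sum6 u by rewrite /s6 !quE.
have s6c : continuous s6 by rewrite /s6; continuity.
pose D := [set u | Q _ nonnegG u /\ s6 u = 1].
have Dc : closed D.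
  rewrite (_ : D = [set u | forall x y (g : inG x y), 0 <= qu x y u]
      `&` [set u | 0 <= s6 u - 1] `&` [set u | 0 <= 1 - s6 u]).
    repeat apply: closedI; try by apply: closed_ge0; continuity.
    by do 3!(apply: closed_forall => ?); apply: closed_ge0.
  apply/seteqP; split => u /=; rewrite !subr_ge0.
    by move=> [h ->]; do 2!split => //; move=> x y g; rewrite quE; exact: h.
  move=> [[h h1] h2]; split; last by apply/le_anti; rewrite h1 h2.
  by move=> x y g; have := h x y g; rewrite quE.
have row p d e a b c T (F : R -> R -> R -> R -> R -> R -> T) :
    Q _ F (row6 [:: p; d; e; a; b; c]) = F p d e a b c.
  by rewrite /Q /C !mxE !inordK.
have hE u : frob Y (sym6 u) = Q _ (fun p d e a b c => frob Y (sym3 p d e a b c)) u by [].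
have norm p d e a b c : nonnegG p d e a b c -> 0 < sum6 p d e a b c ->
    let s := sum6 p d e a b c in
    D (row6 [:: p / s; d / s; e / s; a / s; b / s; c / s]) /\
    frob Y (sym6 (row6 [:: p / s; d / s; e / s; a / s; b / s; c / s]))
      = frob Y (sym3 p d e a b c) / s.
  move=> qpos s0 s.
  have sN : s != 0 by rewrite gt_eqF.
  have qs x y : qv (p / s) (d / s) (e / s) (a / s) (b / s) (c / s) x y = qv p d e a b c x y / s.
    by rewrite /qv; field.
  split; last by rewrite hE row !frob_sym3; field.
  split; first by rewrite row => x y g; rewrite qs divr_ge0 ?qpos // ltW.
  by rewrite s6E row /sum6 !qs -!mulrDl divff.
have s0 : 0 < sum6 p0 d0 e0 a0 b0 c0 by apply: (sum6_gt0 q0 (Y := Y)); rewrite lt_eqF.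
have [D0 h0] := norm _ _ _ _ _ _ q0 s0.
have [|||u [Du su] umin] := @rV_min _ _ D 1000 (fun u => frob Y (sym6 u)) Dc.
- move=> u [/coef_bound Du su] i.
  have [] := Du 1; first by rewrite -su s6E.
  rewrite mulr1; move: (mem_row6 u i); rewrite !inE => hi [h1 h2 h3] [h4 h5 h6].
  by move: hi; do 5?[case/orP]; move=> /eqP->.
- by exists (row6 [:: p0 / sum6 p0 d0 e0 a0 b0 c0; d0 / sum6 p0 d0 e0 a0 b0 c0;
    e0 / sum6 p0 d0 e0 a0 b0 c0; a0 / sum6 p0 d0 e0 a0 b0 c0; b0 / sum6 p0 d0 e0 a0 b0 c0;
    c0 / sum6 p0 d0 e0 a0 b0 c0]).
- apply: continuous_frob; first by move=> i j; exact: cst_continuous.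
  by apply: sym3_continuous; exact: Cc.
exists (C 0 u), (C 1 u), (C 2 u), (C 3 u), (C 4 u), (C 5 u); split => //.
- rewrite -[frob _ _]/(frob Y (sym6 u)); apply: (le_lt_trans (umin _ D0)).
  by rewrite h0 pmulr_llt0 // invr_gt0.
- move=> p d e a b c qp; rewrite -[X in X * _]/(frob Y (sym6 u)).
  (* A nonzero pairing makes [sum6] positive, so the quadratic can be normalised. A zero pairing
     leaves only the sign of the left-hand side, which is nonpositive. *)
  have [Yq|Yq] := eqVneq (frob Y (sym3 p d e a b c)) 0; last first.
    have s1 := sum6_gt0 qp Yq; have [D1 h1] := norm _ _ _ _ _ _ qp s1.
    by have := umin _ D1; rewrite h1 ler_pdivlMr.
  rewrite Yq mulr_le0_ge0 ?sum6_ge0 //.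
    by apply: (le_trans (umin _ D0)); rewrite h0 pmulr_lle0 ?invr_gt0 // ltW.
Qed.


Lemma psd_rank1_ge0 (Y : 'M[R]_3) (l m n : R) : psd Y ->
  0 <= frob Y (sym3 (n ^+ 2) (l * n) (m * n) (l ^+ 2) (l * m) (m ^+ 2)).
Proof.
move=> [_ Y0].
pose v : 'cV[R]_3 := mx_of_rows 3 1 [:: [:: n]; [:: l]; [:: m]].
have -> : sym3 (n ^+ 2) (l * n) (m * n) (l ^+ 2) (l * m) (m ^+ 2) = v *m v^T.
  by apply: mx3P; split; rewrite mxE [RHS]mxE big_ord1 !mxE /=; ring.
by rewrite frob_rank1.
Qed.

(** The matrix is that of the square of l x + m y + n, so the sum is one of six squares; an affine
    form vanishing at the three noncollinear points (1/2, 1/2), (1, 1/2) and (1/2, 1) is zero. *)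
Lemma sum6_square_gt0 (l m n : R) : [|| l != 0, m != 0 | n != 0] ->
  0 < sum6 (n ^+ 2) (l * n) (m * n) (l ^+ 2) (l * m) (m ^+ 2).
Proof.
have E : sum6 (n ^+ 2) (l * n) (m * n) (l ^+ 2) (l * m) (m ^+ 2) =
   (l / 2 + m / 2 + n) ^+ 2 + (3 * l / 4 + m / 2 + n) ^+ 2 + (l + m / 2 + n) ^+ 2
   + (l / 2 + 3 * m / 4 + n) ^+ 2 + (l / 2 + m + n) ^+ 2 + (3 * l / 4 + 3 * m / 4 + n) ^+ 2.
  by rewrite /sum6 /qv; field.
move=> H; rewrite ltNge; apply/negP; rewrite E => h.
have z x : x ^+ 2 <= 0 -> x = 0 :> R.
  by move=> x0; apply/eqP; rewrite -sqrf_eq0; apply/eqP/le_anti; rewrite x0 sqr_ge0.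
have := sqr_ge0 (l / 2 + m / 2 + n); have := sqr_ge0 (3 * l / 4 + m / 2 + n).
have := sqr_ge0 (l + m / 2 + n); have := sqr_ge0 (l / 2 + 3 * m / 4 + n).
have := sqr_ge0 (l / 2 + m + n); have := sqr_ge0 (3 * l / 4 + 3 * m / 4 + n).
move: (z (l / 2 + m / 2 + n)) (z (l + m / 2 + n)) (z (l / 2 + m + n)) h.
move: ((l / 2 + m / 2 + n) ^+ 2) ((3 * l / 4 + m / 2 + n) ^+ 2) ((l + m / 2 + n) ^+ 2)
  ((l / 2 + 3 * m / 4 + n) ^+ 2) ((l / 2 + m + n) ^+ 2) ((3 * l / 4 + 3 * m / 4 + n) ^+ 2).
move=> s1 s2 s3 s4 s5 s6 z1 z2 z3 h g1 g2 g3 g4 g5 g6.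
have {}z1 : l / 2 + m / 2 + n = 0 by apply: z1; lra.
have {}z2 : l + m / 2 + n = 0 by apply: z2; lra.
have {}z3 : l / 2 + m + n = 0 by apply: z3; lra.
have l0 : l = 0 by lra.
have m0 : m = 0 by lra.
have n0 : n = 0 by lra.
by move: H; rewrite l0 m0 n0 eqxx.
Qed.

Lemma Cbar_of_duals (Y : 'M[R]_3) : psd Y -> Y 0 0 = 1 ->
  (forall p d e a b c, nonnegG p d e a b c -> qv p d e a b c (1 / 2) 2 = 0 ->
    0 <= frob Y (sym3 p d e a b c)) ->
  (forall p d e a b c, nonnegG p d e a b c -> qv p d e a b c 2 (1 / 2) = 0 ->
    0 <= frob Y (sym3 p d e a b c)) ->
  Cbar (G R) Y.
Proof.
move=> Yp Y1 YB YC; have Ys := Yp.1.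
have [//|/(Cbar_separation Ys Y1)/extremal_separator] := pselect (Cbar (G R) Y).
move=> [p [d [e [a [b [c [q0 m0 s1 ext]]]]]]]; exfalso.
set m := frob Y _ in m0 ext.
have GB : inG (1 / 2 : R) 2 by split; try (apply/andP; split); lra.
have GC : inG (2 : R) (1 / 2) by exact: inGC.
apply: (noncollinear_zeros_absurd q0).
- rewrite lt_def q0 // andbT; apply/eqP => h.
  by have := YB _ _ _ _ _ _ q0 h; rewrite leNgt m0.
- rewrite lt_def q0 // andbT; apply/eqP => h.
  by have := YC _ _ _ _ _ _ q0 h; rewrite leNgt m0.
move=> l k n lkn; apply: contrapT => nex.
have z x y : inG x y -> qv p d e a b c x y = 0 -> l * x + k * y + n = 0.
  move=> g h; apply/eqP/negPn/negP => h2; apply: nex; by exists x, y.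
have W0 := sum6_square_gt0 lkn.
set W := sum6 _ _ _ _ _ _ in W0.
have Yl := psd_rank1_ge0 l k n Yp; set V := frob _ _ in Yl.
(* Extremality applied to [ep] plus [K] times the minimiser minus the square gives
   [- m * W + V <= ep * (1 - 6 * m)], 6 being [sum6] of the constant 1. This [ep] makes the
   right-hand side half of [- m * W], a contradiction as [V >= 0]. *)
pose ep := - m * W / (2 * (1 - 6 * m)).
have dm : 0 < 2 * (1 - 6 * m) by lra.
have mW : 0 < - m * W by rewrite mulr_gt0 // oppr_gt0.
have ep0 : 0 < ep by rewrite divr_gt0.
have [K [K0 dom]] := linear_form_domination q0 z ep0.
have qq : nonnegG (ep + K * p - n ^+ 2) (K * d - l * n) (K * e - k * n) (K * a - l ^+ 2)
    (K * b - l * k) (K * c - k ^+ 2).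
  by move=> x y g; have := dom x y g; rewrite /qv; lra.
have := ext _ _ _ _ _ _ qq.
have -> : frob Y (sym3 (ep + K * p - n ^+ 2) (K * d - l * n) (K * e - k * n) (K * a - l ^+ 2)
    (K * b - l * k) (K * c - k ^+ 2)) = ep + K * m - V.
  by rewrite /m /V !frob_sym3 Y1; ring.
have -> : sum6 (ep + K * p - n ^+ 2) (K * d - l * n) (K * e - k * n) (K * a - l ^+ 2)
    (K * b - l * k) (K * c - k ^+ 2) = 6 * ep + K * sum6 p d e a b c - W.
  by rewrite /W /sum6 /qv; ring.
rewrite s1.
have : ep * (2 * (1 - 6 * m)) = - m * W by rewrite divfK // gt_eqF.
lra.
Qed.

End ExtremalSeparator.

(** * Characterisation of the hull and its semidefinite extended formulation *)

Section ExtendedFormulation.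
Context {R : realType}.

Lemma dual_cone_decomposable (Y : 'M[R]_3) : dual_cone (N_B R) Y <-> decomposable Y.
Proof. by split; [exact: dual_decomposable|exact: decomposable_dual]. Qed.

Definition swap3 (Y : 'M[R]_3) : 'M[R]_3 :=
  sym3 (Y 0 0) (Y 0 ord_max) (Y 0 1) (Y ord_max ord_max) (Y 1 ord_max) (Y 1 1).

Lemma frob_swap3 (Y : 'M[R]_3) p d e a b c : Y \is symmetricmx ->
  frob (swap3 Y) (sym3 p d e a b c) = frob Y (sym3 p e d c b a).
Proof. by move=> Ys; rewrite frob_sym3_swap -symmetric_sym3. Qed.

Lemma Cbar_char (Y : 'M[R]_3) : Cbar (G R) Y <->
  [/\ psd Y, Y 0 0 = 1, dual_cone (N_B R) Y & dual_cone (N_B R) (swap3 Y)].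
Proof.
split=> [CY|[Yp Y1 [Ys YB] [_ YC]]].
  have Ys := Cbar_symmetric CY; split.
  - exact: Cbar_psd CY.
  - exact: Cbar_corner CY.
  - split=> // Q /N_B_sym3[p [d [e [a [b [c [-> q0 _]]]]]]]; exact: Cbar_nonnegG.
  - split=> [|Q /N_B_sym3[p [d [e [a [b [c [-> q0 _]]]]]]]]; first exact: sym3_symmetric.
    rewrite frob_swap3 //; apply: Cbar_nonnegG => // x y g.
    by rewrite qvC; apply: q0; exact: inGC.
apply: Cbar_of_duals => // p d e a b c q0 q1.
  by apply: YB; apply/N_B_sym3; exists p, d, e, a, b, c.
rewrite -frob_swap3 //; apply: YC; apply/N_B_sym3; exists p, e, d, c, b, a.
by split => //; [move=> x y g; rewrite -qvC; apply: q0; exact: inGC|rewrite -qvC].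
Qed.

Lemma linear_bundle (U V : lmodType R) (f : U -> V) : linear f ->
  exists F : {linear U -> V}, F =1 f.
Proof.
move=> hf; pose F : {linear U -> V} := HB.pack f (GRing.isLinear.Build R U V *:%R f hf).
by exists F.
Qed.

(** A relation between [Y] and [u], kept unprojected so that conjunctions can share the auxiliary
    row before it is quantified. *)
Definition lmi n m (P : 'M[R]_n -> 'rV[R]_m -> Prop) : Prop :=
  exists (k : nat) (s : 'I_k -> nat) (A : forall i, 'M[R]_(s i))
    (F : forall i, {linear 'M[R]_n -> 'M[R]_(s i)})
    (H : forall i, {linear 'rV[R]_m -> 'M[R]_(s i)}),
    forall Y u, P Y u <-> forall i, psd (A i + F i Y + H i u).

Lemma lmi_formulation n m (P : 'M[R]_n -> 'rV[R]_m -> Prop) (C : set 'M[R]_n) :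
  lmi P -> (forall Y, C Y <-> exists u, P Y u) -> semidefinite_extended_formulation C.
Proof.
move=> [k [s [A [F [H PE]]]]] CE; exists m, k, s, A, F, H.
by apply/seteqP; split => Y /= => [/CE[u /PE Pu]|[u /PE Pu]]; [exists u|apply/CE; exists u].
Qed.

Lemma lmi_iff n m (P P' : 'M[R]_n -> 'rV[R]_m -> Prop) :
  (forall Y u, P Y u <-> P' Y u) -> lmi P -> lmi P'.
Proof.
move=> PP' [k [s [A [F [H PE]]]]]; exists k, s, A, F, H => Y u.
by rewrite -PE; exact: iff_sym.
Qed.

Lemma lmi_block n m s (A : 'M[R]_s) (f : 'M[R]_n -> 'M[R]_s) (g : 'rV[R]_m -> 'M[R]_s) :
  linear f -> linear g -> lmi (fun Y u => psd (A + f Y + g u)).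
Proof.
move=> /linear_bundle[F FE] /linear_bundle[H HE].
exists 1%N, (fun=> s), (fun=> A), (fun=> F), (fun=> H) => Y u.
by rewrite FE HE; split => // h; exact: (h 0).
Qed.

Lemma lmi_and n m (P P' : 'M[R]_n -> 'rV[R]_m -> Prop) :
  lmi P -> lmi P' -> lmi (fun Y u => P Y u /\ P' Y u).
Proof.
move=> [k1 [s1 [A1 [F1 [H1 E1]]]]] [k2 [s2 [A2 [F2 [H2 E2]]]]].
(* The two families of blocks are indexed by a disjoint sum, so that sizes and maps are defined by
   cases, and then transported to one ordinal. *)
pose s (z : 'I_k1 + 'I_k2) := match z with inl i => s1 i | inr i => s2 i end.
pose A z : 'M[R]_(s z) := match z with inl i => A1 i | inr i => A2 i end.
pose F z : {linear 'M[R]_n -> 'M[R]_(s z)} := match z with inl i => F1 i | inr i => F2 i end.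
pose H z : {linear 'rV[R]_m -> 'M[R]_(s z)} := match z with inl i => H1 i | inr i => H2 i end.
exists (k1 + k2)%N, (fun i => s (fintype.split i)), (fun i => A (fintype.split i)),
  (fun i => F (fintype.split i)), (fun i => H (fintype.split i)) => Y u.
have -> : (forall i, psd (A (fintype.split i) + F (fintype.split i) Y + H (fintype.split i) u))
    <-> (forall z, psd (A z + F z Y + H z u)).
  by split => h z; [have := h (unsplit z); rewrite unsplitK|exact: h].
rewrite E1 E2; split => [[h1 h2] [i|i]|h]; [exact: h1|exact: h2|].
by split => i; [exact: (h (inl i))|exact: (h (inr i))].
Qed.

(* A block of psd (block_mx 0 E 0 0) is symmetric exactly when E = 0. *)
Lemma lmi_eq n m s (A : 'M[R]_s) (f : 'M[R]_n -> 'M[R]_s) (g : 'rV[R]_m -> 'M[R]_s) :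
  linear f -> linear g -> lmi (fun Y u => A + f Y + g u = 0).
Proof.
move=> lf lg; pose B (E : 'M[R]_s) := @block_mx R s s s s 0 E 0 0.
have BD E E' : B E + B E' = B (E + E') by rewrite /B add_block_mx !addr0.
have BZ t E : t *: B E = B (t *: E) by rewrite /B scale_block_mx !scaler0.
apply: (@lmi_iff _ _ (fun Y u => psd (B A + B (f Y) + B (g u)))); last first.
  by apply: lmi_block => t x y; rewrite BZ BD ?lf ?lg.
move=> Y u; rewrite !BD; split => [[/symmetricmxE h _]|->].
  apply/matrixP => i j; have := h (lshift s i) (rshift s j).
  by rewrite block_mxEur block_mxEdl => ->; rewrite !mxE.
have -> : B 0 = 0 by rewrite /B block_mx_const.
split; first by apply: symmetricmxP => i j; rewrite !mxE.
by move=> v; rewrite mulmx0 mul0mx mxE.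
Qed.

Definition is_linear_form m (f : 'rV[R]_m -> R) : Prop :=
  forall t x y, f (t *: x + y) = t * f x + f y.

Lemma lmi_psd2 n m (f g h : 'rV[R]_m -> R) :
  is_linear_form f -> is_linear_form g -> is_linear_form h ->
  lmi (fun (Y : 'M[R]_n) u => psd2 (f u) (g u) (h u)).
Proof.
move=> lf lg lh.
pose B u : 'M[R]_2 := mx_of_rows 2 2 [:: [:: f u; g u]; [:: g u; h u]].
apply: (@lmi_iff _ _ (fun (Y : 'M[R]_n) u => psd (0 + 0 *: mx_of_rows 2 2 [::] + B u))).
  by move=> Y u; rewrite scale0r !add0r; exact: psd_psd2.
apply: (@lmi_block _ _ _ 0 (fun=> 0 *: mx_of_rows 2 2 [::])).
  by move=> t x y; rewrite !scale0r scaler0 addr0.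
by move=> t x y; apply: mx2P; rewrite !mxE /= ?lf ?lg ?lh.
Qed.

(** A scalar inequality is a block of size two whose other entries are zero. *)
Lemma lmi_ge0 n m (f : 'rV[R]_m -> R) : is_linear_form f ->
  lmi (fun (Y : 'M[R]_n) u => 0 <= f u).
Proof.
move=> lf; apply: (@lmi_iff _ _ (fun Y u => psd2 (f u) 0 0)); last first.
  by apply: lmi_psd2 => // t x y; rewrite mulr0 addr0.
move=> Y u; split => [/(_ 1 0)|f0 x y]; first by lra.
by rewrite !mulr0 !mul0r !addr0 mulr_ge0 ?sqr_ge0.
Qed.

Lemma lmi_feas n m (g : 'rV[R]_m -> 'rV[R]_10) : linear g ->
  lmi (fun (Y : 'M[R]_n) u => feas (g u)).
Proof.
move=> lg.
have le k t x y : ent (g (t *: x + y)) k = t * ent (g x) k + ent (g y) k.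
  by rewrite lg entD entZ.
apply: (@lmi_iff _ _ (fun (Y : 'M[R]_n) u =>
   (0 <= ent (g u) 0 /\ 0 <= ent (g u) 1) /\
   (psd2 (ent (g u) 2) (ent (g u) 3) (ent (g u) 4) /\
    (0 <= 5 / 2 * ent (g u) 3 - ent (g u) 4 - ent (g u) 2 /\
    (psd2 (ent (g u) 6 - 1 / 2 * ent (g u) 5) (ent (g u) 7 - 1 / 2 * ent (g u) 6)
          (ent (g u) 8 - 1 / 2 * ent (g u) 7) /\
     psd2 (2 * ent (g u) 5 - ent (g u) 6) (2 * ent (g u) 6 - ent (g u) 7)
          (2 * ent (g u) 7 - ent (g u) 8)))))).
  by move=> Y u; split => [[? [? [? []]]]|[? ? ? ? ?]].
by do !apply: lmi_and; first [apply: lmi_ge0|apply: lmi_psd2] => t x y; rewrite !le; ring.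
Qed.

Lemma Cbar_formulation : semidefinite_extended_formulation (Cbar (G R)).
Proof.
(* The auxiliary row holds two sets of ten coordinates: one decomposes [Y], the other its image
   under the exchange of the two variables. *)
pose lu (u : 'rV[R]_(10 + 10)) : 'rV[R]_10 := lsubmx u.
pose ru (u : 'rV[R]_(10 + 10)) : 'rV[R]_10 := rsubmx u.
have llu : linear lu by move=> t x y; apply/matrixP => i j; rewrite !mxE.
have lru : linear ru by move=> t x y; apply/matrixP => i j; rewrite !mxE.
pose e00 (Y : 'M[R]_3) : 'M[R]_1 := \matrix_(i, j) Y 0 0.
apply: (@lmi_formulation _ _ (fun Y u => psd (0 + Y + 0 *: (0 : 'M[R]_3)) /\
   (- 1%:M + e00 Y + 0 *: (0 : 'M[R]_1) = 0 /\
   ((feas (lu u) /\ 0 + Y + - comb (lu u) = 0) /\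
    (feas (ru u) /\ 0 + swap3 Y + - comb (ru u) = 0))))).
  have lz s : linear (fun _ : 'rV[R]_(10 + 10) => 0 *: (0 : 'M[R]_s)).
    by move=> t x y; rewrite !scaler0 addr0.
  have lc (g : 'rV[R]_(10 + 10) -> 'rV[R]_10) : linear g -> linear (fun u => - comb (g u)).
    by move=> lg t x y; rewrite lg combD combZ opprD scalerN.
  apply: lmi_and; first by apply: lmi_block => //.
  apply: lmi_and.
    by apply: lmi_eq => // t x y; apply/matrixP => i j; rewrite !mxE.
  apply: lmi_and; apply: lmi_and; try exact: lmi_feas.
    by apply: lmi_eq => //; exact: lc.
  apply: lmi_eq; last exact: lc.
  by move=> t x y; apply: mx3P; split; rewrite !mxE.
move=> Y; rewrite Cbar_char.
have e1 : - 1%:M + e00 Y + 0 *: (0 : 'M[R]_1) = 0 <-> Y 0 0 = 1.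
  split => [/matrixP/(_ 0 0)|h]; first by rewrite !mxE /=; lra.
  by apply/matrixP => i j; rewrite !mxE !ord1 h /=; ring.
have e2 (U V : 'M[R]_3) : 0 + U + - V = 0 <-> U = V.
  by rewrite add0r; split => [/eqP|->]; [rewrite subr_eq0 => /eqP|rewrite subrr].
split => [[Yp Y1 /dual_cone_decomposable/decomposable_feas[v fv Yv]
    /dual_cone_decomposable/decomposable_feas[w fw Yw]]|].
  exists (row_mx v w); rewrite e1 !e2 /lu /ru row_mxKl row_mxKr add0r scale0r addr0.
  by do !split => //; case: Yp.
move=> [u []]; rewrite e1 !e2 add0r scale0r addr0 => Yp [Y1 [[fl El] [fr Er]]].
by split => //; apply/dual_cone_decomposable/decomposable_feas; [exists (lu u)|exists (ru u)].
Qed.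

End ExtendedFormulation.

Theorem theorem3p2 (R : realType) :
  [/\ Cbar (G R) =
        [set Y | exists (x : 'cV[R]_2) (X : 'M[R]_2),
          [/\ X \is symmetricmx,
              Y = bordered 1 x X,
              psd (bordered 1 x X),
              dual_cone (N_B R) (bordered 1 x X)
            & dual_cone (N_B R)
                (mx_of_rows 3 3
                  [:: [:: 1;     x 1 0; x 0 0];
                      [:: x 1 0; X 1 1; X 0 1];
                      [:: x 0 0; X 0 1; X 0 0]])]],
      dual_cone (N_B R) =
        minkowski_sum (minkowski_sum (minkowski_sum (D_1 R) (D_2 R)) (D_3 R))
          (span1 (z_B R *m (z_B R)^T)),
      forall Y : 'M[R]_3, dual_cone (N_B R) Y <->
        exists (Y1 Y2 Y3 : 'M[R]_3) (l : R),
          [/\ D_1 R Y1, D_2 R Y2, D_3 R Y3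
            & Y = Y1 + Y2 + Y3 + l *: (z_B R *m (z_B R)^T)]
    & semidefinite_extended_formulation (Cbar (G R))].
Proof.
split; last exact: Cbar_formulation.
(* Identifies the matrix with exchanged variables in the statement as [swap3] of the bordered
   matrix. *)
- have swapE (x : 'cV[R]_2) (X : 'M[R]_2) : X \is symmetricmx ->
      swap3 (bordered 1 x X) = sym3 1 (x 1 0) (x 0 0) (X 1 1) (X 0 1) (X 0 0).
    by move=> Xs; rewrite bordered_sym3 // /swap3; congr sym3; rewrite !mxE.
  apply/seteqP; split => [Y CY|_ [x [X [Xs -> Yp YB YC]]]]; last first.
    apply/Cbar_char; rewrite swapE //; split => //.
    by rewrite bordered_sym3 // mxE.
  have [Yp Y1 YB YC] := (Cbar_char Y).1 CY.
  pose x := vec2 (Y 0 1) (Y 0 ord_max).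
  pose X : 'M[R]_2 :=
    mx_of_rows 2 2 [:: [:: Y 1 1; Y 1 ord_max]; [:: Y 1 ord_max; Y ord_max ord_max]].
  have Xs : X \is symmetricmx.
    by apply: symmetricmxP => -[[|[|//]] ?] [[|[|//]] ?]; rewrite !mxE.
  have YE : bordered 1 x X = Y.
    by rewrite bordered_sym3 // [RHS](symmetric_sym3 Yp.1) Y1; congr sym3; rewrite mxE.
  exists x, X; rewrite YE; split => //.
  by move: YC; rewrite -YE swapE.
- apply/seteqP; split => Y.
    move=> /dual_cone_decomposable[Y1 [Y2 [Y3 [l [h1 h2 h3 ->]]]]].
    exists (Y1 + Y2 + Y3); last by exists (l *: (z_B R *m (z_B R)^T)) => //; exists l.
    by exists (Y1 + Y2); [exists Y1 => //; exists Y2|exists Y3].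
  move=> [_ [_ [Y1 h1 [Y2 h2 <-]] [Y3 h3 <-]] [_ [l _ <-] <-]].
  by apply/dual_cone_decomposable; exists Y1, Y2, Y3, l.
- exact: dual_cone_decomposable.
Qed.
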